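(* Let $C^\ast$ be the smallest constant $C$ such that $$\int_0^L u(s)^4\,ds\ \le\ C\, L\left(\int_0^L u(s)^2\,ds\right)\left(\int_0^L (u'(s))^2\,ds\right)$$ holds for every $L>0$ and every $C^2$ function $u:[0,L]\to\mathbb R$ with $u'(0)=u'(L)=0$ and $\int_0^L u(s)\,ds=0$. Then $$\frac1{2\pi}<0.162277< C^\ast<0.162278 .$$ In particular the inequality fails for some such $u$ if $C=\frac1{2\pi}$.
   Context: All objects are standard. *)

(* Defs.v *)
From Stdlib Require Import Reals.
From Coquelicot Require Import Coquelicot.
Open Scope R_scope.

Definition segment (L x : R) : Prop := 0 <= x <= L.

(* [u1] is the derivative of [u] on [0,L], one-sided at the endpoints; the
   values of [u] and [u1] outside [0,L] play no role. *)
Definition derivative_on (L : R) (u u1 : R -> R) : Prop :=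
  forall x, segment L x -> D_in u u1 (segment L) x.

(* [u] is of class C^2 on [0,L] with first derivative [u1]. *)
Definition C2_on (L : R) (u u1 : R -> R) : Prop :=
  derivative_on L u u1 /\
  exists u2 : R -> R,
    derivative_on L u1 u2 /\
    forall x, segment L x -> continue_in u2 (segment L) x.

(* On [0,L] with 0 < L, [u1] is uniquely determined by [u], so that carrying it
   along is the same as writing u'. *)
Definition test_function (L : R) (u u1 : R -> R) : Prop :=
  C2_on L u u1 /\ u1 0 = 0 /\ u1 L = 0 /\ RInt u 0 L = 0.

Definition inequality (C L : R) (u u1 : R -> R) : Prop :=
  RInt (fun s => u s ^ 4) 0 L <=
    C * L * RInt (fun s => u s ^ 2) 0 L * RInt (fun s => u1 s ^ 2) 0 L.

Definition admissible (C : R) : Prop :=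
  forall (L : R) (u u1 : R -> R),
    0 < L -> test_function L u u1 -> inequality C L u u1.

Definition is_smallest (P : R -> Prop) (C : R) : Prop :=
  P C /\ forall C', P C' -> C <= C'.

(* Main.v *)
Require Import Defs.
From Stdlib Require Import Reals Machin ZArith List Lra Lia Psatz.
From Coquelicot Require Import Coquelicot.
Import ListNotations.
Open Scope R_scope.

(** Upper bound: normalise [u] to mean 0 and mean square 1, and let [m,M] be its range,
    so that [-mM >= 1].  If the quartic [P(v) = A + B v + C v^2 - v^4] is nonnegative on
    [m,M], integrating [u'^2 >= 2 t |u'| sqrt(P(u)) - t^2 P(u)] with [t = 2 kappa / L]
    turns [int_m^M sqrt P >= kappa (A + C)] into the inequality with constant
    [1 / (4 kappa^2)]; no rearrangement of [u] is needed.  With [s = m + M],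
    [rho = (M - m) / 2], [sigma = s / rho], the choice
    [P(v) = (v - m) (M - v) ((v + s/2)^2 + rho^2 k)] leads to
    [rho J(k,sigma) >= kappa G(rho,sigma,k)], where
    [J(k,sigma) = int_0^PI sin^2 sqrt(k + (sigma - cos)^2)] is an elliptic integral and [G]
    a polynomial.  Given [(rho,sigma)] one has to find a suitable [k].  Simple estimates
    settle the case that [rho] or [sigma] is extreme; on a remaining rectangle, where the
    symmetric extremal [cn] makes the inequality sharp up to [10^-6], [J] is bounded below by
    replacing [sqrt Q] by a polynomial in [Q] and in an approximation of [Q^(-1/2)], and the
    resulting polynomial inequalities are checked by computation on a subdivision.
    Lower bound: a truncated Fourier series of [cn]. *)

(** * Polynomials and moments of the cosine *)

(** One set of list algorithms serves the integers and the iterated polynomial rings over them. The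
    record carries no laws: correctness is expressed only through an evaluation into the reals. *)
Record ring_ops (A : Type) := RingOps {
  ofZ : Z -> A; add : A -> A -> A; mul : A -> A -> A }.
Arguments ofZ {A}. Arguments add {A}. Arguments mul {A}.

Record ring_eval {A : Type} (o : ring_ops A) (ev : A -> R) : Prop := RingEval {
  ev_ofZ : forall z, ev (ofZ o z) = IZR z;
  ev_add : forall a b, ev (add o a b) = ev a + ev b;
  ev_mul : forall a b, ev (mul o a b) = ev a * ev b }.

Fixpoint power {A} (o : ring_ops A) (a : A) (n : nat) : A :=
  match n with O => ofZ o 1 | S m => mul o a (power o a m) end.

Lemma ev_power {A} (o : ring_ops A) ev a n :
  ring_eval o ev -> ev (power o a n) = ev a ^ n.
Proof.
intros H; induction n as [|n IH]; simpl.
- now rewrite (ev_ofZ _ _ H).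
- now rewrite (ev_mul _ _ H), IH.
Qed.

Definition Z_ops : ring_ops Z := RingOps Z (fun z => z) Z.add Z.mul.

Lemma Z_eval : ring_eval Z_ops IZR.
Proof. split; [easy | apply plus_IZR | apply mult_IZR]. Qed.

Fixpoint list_add {A} (f : A -> A -> A) (p q : list A) : list A :=
  match p, q with
  | [], _ => q
  | _, [] => p
  | a :: p', b :: q' => f a b :: list_add f p' q'
  end.

Fixpoint list_mul {A} (o : ring_ops A) (p q : list A) : list A :=
  match p with
  | [] => []
  | a :: p' => list_add (add o) (map (mul o a) q) (ofZ o 0 :: list_mul o p' q)
  end.

(* Constant coefficient first. *)
Definition poly_ops {A} (o : ring_ops A) : ring_ops (list A) :=
  RingOps (list A) (fun z => [ofZ o z]) (list_add (add o)) (list_mul o).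

Fixpoint peval {A} (ev : A -> R) (p : list A) (x : R) : R :=
  match p with [] => 0 | a :: p' => ev a + x * peval ev p' x end.

Lemma poly_eval {A} (o : ring_ops A) ev x :
  ring_eval o ev -> ring_eval (poly_ops o) (fun p => peval ev p x).
Proof.
intros H.
assert (Hadd : forall p q, peval ev (list_add (add o) p q) x = peval ev p x + peval ev q x).
{ induction p as [|a p IH]; intros [|b q]; simpl; try ring.
  rewrite (ev_add _ _ H), IH; ring. }
assert (Hscale : forall a q, peval ev (map (mul o a) q) x = ev a * peval ev q x).
{ intros a q; induction q as [|b q IH]; simpl; [ring|].
  rewrite (ev_mul _ _ H), IH; ring. }
split; simpl.
- intros z; rewrite (ev_ofZ _ _ H); ring.
- apply Hadd.
- intros p q; induction p as [|a p IH]; simpl; [ring|].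
  rewrite Hadd, Hscale; simpl; rewrite (ev_ofZ _ _ H), IH; ring.
Qed.

(** Horner's rule for lower bounds: if [x] is in [0,1] and [p' >= r], then [x * p' >= Z.min 0 r]. *)
Definition plow {A} (low : A -> Z) (p : list A) : Z :=
  fold_right (fun a r => (low a + Z.min 0 r)%Z) 0%Z p.

Lemma plow_le {A} (low : A -> Z) (ev : A -> R) p x :
  (forall a, IZR (low a) <= ev a) -> 0 <= x <= 1 -> IZR (plow low p) <= peval ev p x.
Proof.
intros Hlow Hx; induction p as [|a p IH]; simpl; [lra|].
rewrite plus_IZR; apply Rplus_le_compat; [apply Hlow|].
set (l := plow low p) in *.
destruct (Z.min_spec 0 l) as [[Hl ->]|[Hl ->]]; apply IZR_lt in Hl || apply IZR_le in Hl; nra.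
Qed.

(** Polynomials on the unit square: the inner variable [x] is the relative position of rho in a box,
    the outer variable [z] that of sigma. *)
Definition Z2_ops := poly_ops (poly_ops Z_ops).
Definition eval2 (x z : R) : list (list Z) -> R :=
  fun p => peval (fun q => peval IZR q x) p z.

Lemma Z2_eval x z : ring_eval Z2_ops (eval2 x z).
Proof. apply poly_eval, (poly_eval Z_ops), Z_eval. Qed.

Definition low2 : list (list Z) -> Z := plow (plow (fun z => z)).

Lemma low2_le p x z : 0 <= x <= 1 -> 0 <= z <= 1 -> IZR (low2 p) <= eval2 x z p.
Proof.
intros Hx Hz; apply plow_le; [|easy].
intros q; apply plow_le; [|easy]; intros a; apply Rle_refl.
Qed.

Lemma is_RInt_zero (a b : R) : is_RInt (fun _ => 0) a b 0.
Proof.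
exact (eq_ind _ (is_RInt (fun _ => 0) a b)
         (is_RInt_const (V := R_NormedModule) a b 0) 0 (Rmult_0_r (b - a))).
Qed.

(** Here [w] is a weight, [c] a common denominator and [i] the exponent belonging to the head of the
    list; the factor PI is split off so that the table is integral. *)
Fixpoint moments_match (w : R -> R) (c : R) (i : nat) (ms : list Z) : Prop :=
  match ms with
  | [] => True
  | m :: ms' => is_RInt (fun t => w t * cos t ^ i) 0 PI (PI * (IZR m / c))
                /\ moments_match w c (S i) ms'
  end.

Fixpoint dot {A} (o : ring_ops A) (p : list A) (ms : list Z) : A :=
  match p, ms with
  | a :: p', m :: ms' => add o (mul o a (ofZ o m)) (dot o p' ms')
  | _, _ => ofZ o 0
  end.

Lemma dot_is_RInt {A} (o : ring_ops A) ev w c p ms i :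
  ring_eval o ev -> moments_match w c i ms -> (length p <= length ms)%nat ->
  is_RInt (fun t => w t * cos t ^ i * peval ev p (cos t)) 0 PI (PI * (ev (dot o p ms) / c)).
Proof.
intros H; revert ms i; induction p as [|a p IH]; intros ms i Hms Hlen.
- simpl; rewrite (ev_ofZ _ _ H).
  apply is_RInt_ext with (fun _ => 0); [intros; simpl; ring|].
  replace (PI * (0 / c)) with 0 by (unfold Rdiv; ring); apply is_RInt_zero.
- destruct ms as [|m ms]; simpl in Hlen; [lia|].
  destruct Hms as [Hm Hms].
  simpl; rewrite (ev_add _ _ H), (ev_mul _ _ H), (ev_ofZ _ _ H).
  apply is_RInt_ext with (fun t => plus (scal (ev a) (w t * cos t ^ i)) (w t * cos t ^ S i * peval ev p (cos t))).
  { intros t _; unfold plus, scal; simpl; unfold mult; simpl; ring. }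
  replace (PI * _) with
    (plus (scal (ev a) (PI * (IZR m / c))) (PI * (ev (dot o p ms) / c)))
    by (unfold plus, scal; simpl; unfold mult; simpl; unfold Rdiv; ring).
  apply (is_RInt_plus (V := R_NormedModule)).
  + now apply (is_RInt_scal (V := R_NormedModule)).
  + apply IH; [easy | lia].
Qed.

(** The two-step recurrence of the cosine averages, cross-multiplied so that integer arithmetic
    validates a whole table from its first two entries. *)
Fixpoint moments_ok (i : Z) (ms : list Z) : bool :=
  match ms with
  | m :: ((_ :: m'' :: _) as ms') =>
      ((i + 2) * m'' =? (i + 1) * m)%Z && moments_ok (i + 1) ms'
  | _ => true
  end.

(** The derivative of [cos t ^ S i * sin t] is integrated; this function vanishes at 0 and at PI. *)
Lemma is_RInt_cos_step i v :
  is_RInt (fun t => cos t ^ i) 0 PI v ->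
  is_RInt (fun t => cos t ^ S (S i)) 0 PI ((INR i + 1) / (INR i + 2) * v).
Proof.
intros Hv.
assert (Hi := pos_INR i).
assert (HF : is_RInt (fun t => (INR i + 2) * cos t ^ S (S i) - (INR i + 1) * cos t ^ i) 0 PI
               (minus (cos PI ^ S i * sin PI) (cos 0 ^ S i * sin 0))).
{ apply (is_RInt_derive (fun t => cos t ^ S i * sin t)
           (fun t => (INR i + 2) * cos t ^ S (S i) - (INR i + 1) * cos t ^ i)).
  - intros t _; auto_derive; [easy|].
    change (match i with O => 1 | S _ => INR i + 1 end) with (INR (S i)).
    rewrite S_INR; simpl.
    generalize (sin2_cos2 t); unfold Rsqr; intros Hsc.
    replace ((INR i + 2) * (cos t * (cos t * cos t ^ i)) - (INR i + 1) * cos t ^ i)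
      with (cos t ^ i * (cos t * cos t) - (INR i + 1) * cos t ^ i * (1 - cos t * cos t)) by ring.
    replace (1 - cos t * cos t) with (sin t * sin t) by lra; ring.
  - intros t _.
    apply (ex_derive_continuous (fun t => (INR i + 2) * cos t ^ S (S i) - (INR i + 1) * cos t ^ i)).
    now auto_derive. }
rewrite sin_PI, sin_0 in HF.
apply is_RInt_ext with (fun t => scal (/ (INR i + 2)) (plus
   ((INR i + 2) * cos t ^ S (S i) - (INR i + 1) * cos t ^ i) (scal (INR i + 1) (cos t ^ i)))).
{ intros t _; unfold plus, scal; cbn -[INR pow]; unfold mult; cbn -[INR pow]; field; lra. }
replace ((INR i + 1) / (INR i + 2) * v) with
  (scal (/ (INR i + 2)) (plus (minus (cos PI ^ S i * 0) (cos 0 ^ S i * 0)) (scal (INR i + 1) v))).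
2:{ unfold plus, scal, minus, opp, plus; simpl; unfold mult; simpl; field; lra. }
apply (is_RInt_scal (V := R_NormedModule)), (is_RInt_plus (V := R_NormedModule)); [exact HF|].
now apply (is_RInt_scal (V := R_NormedModule)).
Qed.

Lemma moments_ok_match c i a b ms :
  moments_ok (Z.of_nat i) (a :: b :: ms) = true ->
  is_RInt (fun t => 1 * cos t ^ i) 0 PI (PI * (IZR a / c)) ->
  is_RInt (fun t => 1 * cos t ^ S i) 0 PI (PI * (IZR b / c)) ->
  moments_match (fun _ => 1) c i (a :: b :: ms).
Proof.
revert i a b; induction ms as [|d ms IH]; intros i a b Hok Ha Hb; [simpl; auto|].
change (((Z.of_nat i + 2) * d =? (Z.of_nat i + 1) * a)%Z
        && moments_ok (Z.of_nat i + 1) (b :: d :: ms) = true)%bool in Hok.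
apply andb_prop in Hok as [Hd Hok].
split; [exact Ha|]; apply IH; [| exact Hb |].
- replace (Z.of_nat (S i)) with (Z.of_nat i + 1)%Z by lia; exact Hok.
- apply Z.eqb_eq, (f_equal IZR) in Hd.
  rewrite !mult_IZR, !plus_IZR, <- INR_IZR_INZ in Hd.
  assert (Hi := pos_INR i).
  replace (PI * (IZR d / c)) with ((INR i + 1) / (INR i + 2) * (PI * (IZR a / c))).
  + apply is_RInt_ext with (fun t => cos t ^ S (S i)); [intros t _; now rewrite Rmult_1_l|].
    apply is_RInt_cos_step; eapply is_RInt_ext, Ha; intros t _; apply Rmult_1_l.
  + replace (IZR d) with ((INR i + 1) / (INR i + 2) * IZR a); [unfold Rdiv; ring|].
    field_simplify_eq; [|lra]; lra.
Qed.

(** The average of the power 2j of the cosine is binomial(2j,j) / 4^j, and the table reaches j =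
    33. *)
Definition moment_scale : Z := Eval vm_compute in (2 ^ 66)%Z.

(* [moment_scale] times the averages of [cos^i] over [0,PI]; the scale makes all divisions exact. *)
Fixpoint even_moments (n : nat) (m : Z) (a : Z) : list Z :=
  match n with
  | O => []
  | S n' => a :: 0%Z :: even_moments n' (m + 2) (a * (m + 1) / (m + 2))
  end.
Definition moments : list Z := Eval vm_compute in even_moments 34 0 moment_scale.

Lemma moments_spec : moments_match (fun _ => 1) (IZR moment_scale) 0 moments.
Proof.
apply moments_ok_match.
- vm_compute; reflexivity.
- apply is_RInt_ext with (fun _ => 1); [intros; simpl; ring|].
  replace (PI * _) with (scal (PI - 0) 1).
  + apply (is_RInt_const (V := R_NormedModule)).
  + unfold scal; simpl; unfold mult; simpl.
    change (hd 0%Z moments) with moment_scale.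
    unfold Rdiv; rewrite Rinv_r by now apply not_0_IZR.
    ring.
- replace (PI * _) with (minus (sin PI) (sin 0)).
  + apply (is_RInt_derive sin (fun t => 1 * cos t ^ 1)).
    * intros t _; auto_derive; [easy | ring].
    * intros t _; apply (ex_derive_continuous (fun t => 1 * cos t ^ 1)); now auto_derive.
  + rewrite sin_PI, sin_0; unfold minus, plus, opp; simpl; unfold Rdiv; ring.
Qed.

(** Multiplying the weight by [q] in the cosine turns each moment into the product of [q] with a
    tail of the table. The result ends where the tail becomes shorter than [q], so no moment is ever
    truncated. *)
Fixpoint weighted_moments (q ms : list Z) : list Z :=
  match ms with
  | [] => []
  | _ :: ms' =>
      if (length q <=? length ms)%nat then dot Z_ops q ms :: weighted_moments q ms' else []
  end.

Lemma weighted_moments_match w c i q ms :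
  moments_match w c i ms ->
  moments_match (fun t => w t * peval IZR q (cos t)) c i (weighted_moments q ms).
Proof.
revert i; induction ms as [|m ms IH]; intros i Hms; [easy|].
cbn [weighted_moments]; destruct (Nat.leb_spec (length q) (length (m :: ms))) as [Hlen|_]; [|easy].
split; [|apply IH, Hms].
eapply is_RInt_ext; [|apply (dot_is_RInt Z_ops _ _ _ q _ i Z_eval Hms Hlen)].
intros t _; simpl; ring.
Qed.

Definition sin2_moments : list Z := Eval vm_compute in weighted_moments [1; 0; -1]%Z moments.

Lemma sin2_moments_spec : moments_match (fun t => sin t ^ 2) (IZR moment_scale) 0 sin2_moments.
Proof.
assert (Hext : forall v w c ms i, (forall t, v t = w t) ->
          moments_match v c i ms -> moments_match w c i ms).
{ intros v w c ms i Hvw; revert i; induction ms as [|m ms IH]; intros i; simpl; [easy|].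
  intros [Hm Hms]; split; [|now apply IH].
  eapply is_RInt_ext; [|exact Hm]; intros t _; simpl; now rewrite Hvw. }
eapply Hext; [|apply (weighted_moments_match (fun _ => 1) _ _ [1; 0; -1]%Z moments), moments_spec].
intros t; pose proof (sin2_cos2 t) as Hsc; unfold Rsqr in Hsc; simpl; lra.
Qed.

(** * Certified lower bounds for the elliptic integral *)

(** The elliptic integral J(k,sigma) of the overview. *)
Definition weight_integral (k s : R) : R :=
  RInt (fun t => sin t ^ 2 * sqrt (k + (s - cos t) ^ 2)) 0 PI.

Lemma continuous_weight k s t :
  0 <= k -> continuous (fun t => sin t ^ 2 * sqrt (k + (s - cos t) ^ 2)) t.
Proof.
intros Hk.
apply (continuous_mult (fun t => sin t ^ 2)).
- apply (ex_derive_continuous (fun t => sin t ^ 2)); now auto_derive.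
- apply (continuous_comp (fun t => k + (s - cos t) ^ 2)).
  + apply (ex_derive_continuous (fun t => k + (s - cos t) ^ 2)); now auto_derive.
  + apply continuity_pt_filterlim, continuity_pt_sqrt.
    pose proof (pow2_ge_0 (s - cos t)); lra.
Qed.

Lemma is_RInt_weight_integral k s :
  0 <= k ->
  is_RInt (fun t => sin t ^ 2 * sqrt (k + (s - cos t) ^ 2)) 0 PI (weight_integral k s).
Proof.
intros Hk; apply (RInt_correct (V := R_CompleteNormedModule)), (ex_RInt_continuous (V := R_CompleteNormedModule)).
intros t _; now apply continuous_weight.
Qed.

Lemma weight_integral_ge k s a g v :
  0 <= k ->
  (forall y, -1 <= y <= 1 -> a * g y <= sqrt (k + (s - y) ^ 2)) ->
  is_RInt (fun t => sin t ^ 2 * g (cos t)) 0 PI v -> a * v <= weight_integral k s.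
Proof.
intros Hk Hg Hv.
apply (is_RInt_scal (V := R_NormedModule)) with (k := a) in Hv.
apply (is_RInt_le _ _ 0 PI _ _ (Rlt_le _ _ PI_RGT_0) Hv (is_RInt_weight_integral k s Hk)).
intros t _; unfold scal; simpl; unfold mult; simpl.
pose proof (Hg (cos t) (COS_bound t)) as Hgt; simpl in Hgt.
pose proof (pow2_ge_0 (sin t)) as Hs; simpl in Hs.
nra.
Qed.

(* With [t = h sqrt Q], the difference of the two sides is
   [sqrt Q (t - 1)^4 (5 t^3 + 20 t^2 + 29 t + 16) / 16]. *)
Lemma sqrt_ge_newton h Q :
  0 <= h -> 0 <= Q ->
  h * Q * (35 - 35 * (h * h * Q) + 21 * (h * h * Q) ^ 2 - 5 * (h * h * Q) ^ 3) / 16 <= sqrt Q.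
Proof.
intros Hh HQ.
pose proof (sqrt_pos Q) as Hq.
rewrite <- (sqrt_sqrt Q HQ) at 1 2 3 4.
set (q := sqrt Q) in *; set (t := h * q).
assert (Ht : 0 <= t) by (unfold t; nra).
replace (_ / 16) with (q - q * (((t - 1) ^ 2) ^ 2 * (5 * t ^ 3 + 20 * t ^ 2 + 29 * t + 16)) / 16)
  by (unfold t; field).
assert (0 <= ((t - 1) ^ 2) ^ 2 * (5 * t ^ 3 + 20 * t ^ 2 + 29 * t + 16)).
{ apply Rmult_le_pos; [apply pow2_ge_0|].
  pose proof (pow_le t 2 Ht); pose proof (pow_le t 3 Ht); lra. }
nra.
Qed.

Definition grid : Z := 16384.
Definition h_scale : Z := 1024.

(** Horner's rule for [p] at [(j + x) / n] with denominators cleared; the second component is the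
    common denominator, [n] to the power [length p]. *)
Fixpoint comp_affine (n j : Z) (p : list Z) : list Z * Z :=
  match p with
  | [] => ([], 1%Z)
  | a :: p' =>
      let (r, w) := comp_affine n j p' in
      (list_add Z.add [a * w * n]%Z (list_mul Z_ops [j; 1%Z] r), (w * n)%Z)
  end.

Lemma comp_affine_spec n j p x :
  (0 < n)%Z ->
  let (r, w) := comp_affine n j p in
  (0 < w)%Z /\ peval IZR r x = IZR w * peval IZR p ((IZR j + x) / IZR n).
Proof.
intros Hn.
pose proof (poly_eval Z_ops IZR x Z_eval) as Hev.
assert (Hadd : forall p q, peval IZR (list_add Z.add p q) x = peval IZR p x + peval IZR q x)
  by apply (ev_add _ _ Hev).
assert (Hmul : forall p q, peval IZR (list_mul Z_ops p q) x = peval IZR p x * peval IZR q x)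
  by apply (ev_mul _ _ Hev).
induction p as [|a p IH]; cbn [comp_affine]; [split; [lia | simpl; ring]|].
destruct (comp_affine n j p) as [r w]; destruct IH as [Hw IH]; split; [lia|].
rewrite Hadd, Hmul, IH; simpl.
apply IZR_lt in Hn; rewrite !mult_IZR; field; lra.
Qed.

(** [sqrt_ge_newton] asks for [h >= 0]. The bound [plow] is crude on a long interval, hence eight
    pieces of length 1/4, each rescaled to [0,1]. *)
Definition nonneg_on_m1_1 (h : list Z) : bool :=
  forallb (fun j => (0 <=? plow (fun z => z) (fst (comp_affine 4 j h)))%Z)
    [-4; -3; -2; -1; 0; 1; 2; 3]%Z.

Lemma nonneg_on_m1_1_spec h y :
  nonneg_on_m1_1 h = true -> -1 <= y <= 1 -> 0 <= peval IZR h y.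
Proof.
intros Hh Hy.
assert (Hj : forall j, In j [-4; -3; -2; -1; 0; 1; 2; 3]%Z ->
          IZR j <= 4 * y <= IZR j + 1 -> 0 <= peval IZR h y).
{ intros j Hj Hjy; unfold nonneg_on_m1_1 in Hh; rewrite forallb_forall in Hh.
  specialize (Hh j Hj).
  pose proof (comp_affine_spec 4 j h (4 * y - IZR j) ltac:(lia)) as Hc.
  destruct (comp_affine 4 j h) as [r w]; destruct Hc as [Hw Hc].
  apply Z.leb_le, IZR_le in Hh; apply IZR_lt in Hw.
  pose proof (plow_le (fun z => z) IZR r (4 * y - IZR j) (fun a => Rle_refl _) ltac:(lra)) as Hr.
  replace ((IZR j + (4 * y - IZR j)) / 4) with y in Hc by field.
  simpl in Hh; nra. }
simpl in Hj.
destruct (Rle_lt_dec y (-3/4)); [apply (Hj (-4)%Z); [tauto | lra]|].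
destruct (Rle_lt_dec y (-2/4)); [apply (Hj (-3)%Z); [tauto | lra]|].
destruct (Rle_lt_dec y (-1/4)); [apply (Hj (-2)%Z); [tauto | lra]|].
destruct (Rle_lt_dec y 0); [apply (Hj (-1)%Z); [tauto | lra]|].
destruct (Rle_lt_dec y (1/4)); [apply (Hj 0%Z); [tauto | lra]|].
destruct (Rle_lt_dec y (2/4)); [apply (Hj 1%Z); [tauto | lra]|].
destruct (Rle_lt_dec y (3/4)); [apply (Hj 2%Z); [tauto | lra]|].
apply (Hj 3%Z); [tauto | lra].
Qed.

(* The powers of [h] stay polynomials over [Z], which keeps the computation cheap: only [Q]
   carries the parameters. *)
Fixpoint power_sum_num (cs h2 hp : list Z) (Q Qp : list (list (list Z))) :
    option (list (list Z)) :=
  match cs with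
  | [] => Some (ofZ Z2_ops 0)
  | c :: cs' =>
      let ms := weighted_moments (map (Z.mul c) hp)
                  (firstn (length hp + length Qp) sin2_moments) in
      if (length Qp <=? length ms)%nat then
        match power_sum_num cs' h2 (list_mul Z_ops h2 hp) Q (list_mul Z2_ops Q Qp) with
        | Some T => Some (add Z2_ops (dot Z2_ops Qp ms) T)
        | None => None
        end
      else None
  end.

(** Started with [h2 = h^2], [hp = h] and [Qp = Q], this is the sum of [c_i h^(2i+1) Q^(i+1)], the
    shape of the left side of [sqrt_ge_newton]. *)
Fixpoint power_sum (cs : list Z) (h2 hp Q Qp : R) : R :=
  match cs with
  | [] => 0
  | c :: cs' => IZR c * hp * Qp + power_sum cs' h2 (h2 * hp) Q (Q * Qp)
  end.

Lemma moments_match_firstn w c i n ms :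
  moments_match w c i ms -> moments_match w c i (firstn n ms).
Proof.
revert i n; induction ms as [|m ms IH]; intros i [|n]; simpl; auto.
intros [Hm Hms]; auto.
Qed.

(** In each summand the power of [h] is absorbed into the weight and the power of [Q] is paired with
    the resulting moments. A table that is too short yields [None], never a wrong value. *)
Lemma power_sum_num_spec x z cs h2 hp Q Qp T :
  power_sum_num cs h2 hp Q Qp = Some T ->
  is_RInt (fun t => sin t ^ 2 *
      power_sum cs (peval IZR h2 (cos t)) (peval IZR hp (cos t))
        (peval (eval2 x z) Q (cos t)) (peval (eval2 x z) Qp (cos t))) 0 PI
    (PI * (eval2 x z T / IZR moment_scale)).
Proof.
pose proof (Z2_eval x z) as Hev.
revert hp Qp T; induction cs as [|c cs IH]; intros hp Qp T; cbn [power_sum_num].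
- intros HT; replace T with (ofZ Z2_ops 0) by congruence; rewrite (ev_ofZ _ _ Hev).
  apply is_RInt_ext with (fun _ => 0); [intros; simpl; ring|].
  replace (PI * _) with 0 by (unfold Rdiv; ring); apply is_RInt_zero.
- set (ms := firstn _ sin2_moments).
  assert (Hms : moments_match (fun t => sin t ^ 2) (IZR moment_scale) 0 ms)
    by apply moments_match_firstn, sin2_moments_spec.
  destruct (Nat.leb_spec (length Qp) (length (weighted_moments (map (Z.mul c) hp) ms)))
    as [Hlen|_]; [|easy].
  destruct (power_sum_num cs _ _ _ _) as [T'|] eqn:HT'; [|easy].
  intros HT; replace T with
    (add Z2_ops (dot Z2_ops Qp (weighted_moments (map (Z.mul c) hp) ms)) T')
    by congruence.
  rewrite (ev_add _ _ Hev); clear HT.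
  apply IH in HT'.
  pose proof (dot_is_RInt Z2_ops _ _ _ Qp _ 0 Hev
    (weighted_moments_match _ _ 0 (map (Z.mul c) hp) _ Hms) Hlen) as Hdot.
  replace (PI * _) with
    (plus (PI * (eval2 x z (dot Z2_ops Qp (weighted_moments (map (Z.mul c) hp) ms))
                 / IZR moment_scale)) (PI * (eval2 x z T' / IZR moment_scale)))
    by (unfold plus; simpl; unfold Rdiv; ring).
  eapply is_RInt_ext; [|apply (is_RInt_plus (V := R_NormedModule) _ _ _ _ _ _ Hdot HT')].
  intros t _; cbv beta.
  rewrite (ev_mul _ _ (poly_eval Z_ops IZR (cos t) Z_eval) h2 hp
           : peval IZR (list_mul Z_ops h2 hp) (cos t) = _).
  rewrite (ev_mul _ _ (poly_eval Z2_ops (eval2 x z) (cos t) Hev) Q Qp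
           : peval (eval2 x z) (list_mul Z2_ops Q Qp) (cos t) = _).
  replace (peval IZR (map (Z.mul c) hp) (cos t)) with (IZR c * peval IZR hp (cos t)).
  + unfold plus; simpl; ring.
  + clear; induction hp as [|a p IH]; simpl; [ring|]. rewrite mult_IZR, <- IH; ring.
Qed.

(** * Certificates on boxes in the (rho, sigma) plane *)

Definition pi_num : Z := 3373259426.
Definition kappa_num : Z := 1332723525.
Definition const_den : Z := 1073741824.
(* Chosen such that [1 / (4 kappa^2)] is just below 0.162278. *)
Definition kappa : R := IZR kappa_num / IZR const_den.

(** Partial sums of the alternating series in PI/4 = 2 arctan(1/3) + arctan(1/7). *)
Lemma PI_bounds : IZR pi_num / IZR const_den <= PI <= 3.1415926537.
Proof.
pose proof (PI_2_3_7_ineq 5) as [Hlo Hhi].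
cbn [Nat.mul Nat.add sum_f_R0] in Hlo, Hhi.
unfold tg_alt, PI_2_3_7_tg, Ratan_seq in Hlo, Hhi.
cbn [Nat.mul Nat.add pow INR] in Hlo, Hhi.
unfold pi_num, const_den; lra.
Qed.

(** The polynomial G of the overview: [(A + C) / rho^2] for the quartic with parameter [k]. *)
Definition quartic_weight (rho sigma k : R) : R :=
  (k + sigma ^ 2 / 4) * (rho ^ 2 * (1 - sigma ^ 2 / 4) - 1) + 1 + 3 / 4 * sigma ^ 2.

(* The functions on lists compute with the integers [grid * rho], [grid * sigma], [grid * k]
   and [h_scale * h], and return multiples of the quantities they are named after. *)
Definition quartic_weight_num (r s k : list (list Z)) : list (list Z) :=
  let c := ofZ Z2_ops in
  let plus := add Z2_ops in
  let times := mul Z2_ops in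
  let s2 := times s s in
  plus
    (times (plus (times (c (4 * grid)%Z) k) s2)
       (plus (times (times r r) (plus (c (4 * grid ^ 2)%Z) (times (c (-1)%Z) s2)))
             (c (-4 * grid ^ 4)%Z)))
    (times (c (4 * grid ^ 4)%Z) (plus (c (4 * grid ^ 2)%Z) (times (c 3%Z) s2))).

(** A positive multiple of a lower bound for rho J - kappa G, with PI replaced by
    [pi_num / const_den]; the powers of the scales bring both terms to the same multiple. *)
Definition gap_num (r s k T : list (list Z)) : list (list Z) :=
  add Z2_ops
    (mul Z2_ops (ofZ Z2_ops pi_num) (mul Z2_ops r T))
    (mul Z2_ops (ofZ Z2_ops (- (kappa_num * moment_scale * h_scale ^ 7 * grid ^ 3)))
       (quartic_weight_num r s k)).

(** The scaled [h^2 Q] is [X] times the true one, so the coefficients carry complementary powers of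
    [X] to give all terms of the Newton bound the same scale. *)
Definition integral_num (h : list Z) (k s : list (list Z)) : option (list (list Z)) :=
  let X := ((h_scale * grid) ^ 2)%Z in
  let Q := [add Z2_ops (mul Z2_ops (ofZ Z2_ops grid) k) (mul Z2_ops s s);
            mul Z2_ops (ofZ Z2_ops (-2 * grid)) s; ofZ Z2_ops (grid * grid)] in
  power_sum_num [35 * (X * X * X); -35 * (X * X); 21 * X; -5]%Z (list_mul Z_ops h h) h Q Q.

Definition leaf_ok (r s k : list (list Z)) (h : list Z) : bool :=
  nonneg_on_m1_1 h && (0 <=? low2 k)%Z &&
  match integral_num h k s with
  | Some T => (0 <=? low2 T)%Z && (0 <=? low2 (gap_num r s k T))%Z
  | None => false
  end.

(** The Newton bound makes [T], up to scale, a lower bound for J / PI; a nonnegative gap on the unit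
    square then settles every point of the box with the affine choice of [k]. *)
Lemma leaf_ok_spec r s k h x z rho sigma :
  leaf_ok r s k h = true -> 0 <= x <= 1 -> 0 <= z <= 1 -> 0 <= rho ->
  eval2 x z r = IZR grid * rho -> eval2 x z s = IZR grid * sigma ->
  exists k0, 0 <= k0 /\ kappa * quartic_weight rho sigma k0 <= rho * weight_integral k0 sigma.
Proof.
unfold leaf_ok; cbv zeta.
intros Hok Hx Hz Hrho Hr Hs.
destruct (integral_num h k s) as [T|] eqn:HTeq; rewrite !Bool.andb_true_iff in Hok;
  [destruct Hok as [[Hh Hk] [HT Hgap]] | easy].
apply power_sum_num_spec with (x := x) (z := z) in HTeq.
apply Z.leb_le, IZR_le in Hk, HT, Hgap.
pose proof (low2_le k x z Hx Hz) as Hk'.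
pose proof (low2_le T x z Hx Hz) as HT'.
pose proof (low2_le (gap_num r s k T) x z Hx Hz) as Hgap'.
assert (Hg : 0 < IZR grid) by (apply IZR_lt; reflexivity).
assert (Hhs : 0 < IZR h_scale) by (apply IZR_lt; reflexivity).
assert (Hms : 0 < IZR moment_scale) by (apply IZR_lt; reflexivity).
assert (Hcd : 0 < IZR const_den) by (apply IZR_lt; reflexivity).
pose proof (Z2_eval x z) as Hev.
set (k0 := eval2 x z k / IZR grid).
assert (Hkk : eval2 x z k = IZR grid * k0) by (unfold k0; field; lra).
assert (Hk0 : 0 <= k0) by (unfold k0; apply Rdiv_le_0_compat; lra).
exists k0; split; [exact Hk0|].
(* The scale of [T]: [h_scale * grid^2] from [h * Q], [(h_scale * grid)^6] from [X^3], and the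
   denominator 16 of the Newton bound. *)
set (c := 16 * IZR h_scale ^ 7 * IZR grid ^ 8).
assert (Hc : 0 < c) by (unfold c; apply Rmult_lt_0_compat; [apply Rmult_lt_0_compat|]; auto using pow_lt; lra).
assert (HJ : PI * (eval2 x z T / IZR moment_scale) / c <= weight_integral k0 sigma).
{ replace (PI * _ / c) with (/ c * (PI * (eval2 x z T / IZR moment_scale)))
    by (unfold Rdiv; ring).
  refine (weight_integral_ge _ _ _ (fun y => power_sum _ (peval IZR _ y) (peval IZR _ y)
            (peval (eval2 x z) _ y) (peval (eval2 x z) _ y)) _ Hk0 _ HTeq).
  intros y Hy.
  pose proof (nonneg_on_m1_1_spec h y Hh Hy) as Hhy.
  rewrite (ev_mul _ _ (poly_eval Z_ops IZR y Z_eval) h h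
           : peval IZR (list_mul Z_ops h h) y = _).
  cbn [peval power_sum].
  rewrite !(ev_add _ _ Hev), !(ev_mul _ _ Hev), !(ev_ofZ _ _ Hev), Hs, Hkk.
  set (hy := peval IZR h y / IZR h_scale).
  replace (peval IZR h y) with (IZR h_scale * hy) by (unfold hy; field; lra).
  eapply Rle_trans; [| apply (sqrt_ge_newton hy)].
  - apply Req_le; unfold c; rewrite Z.pow_2_r, !mult_IZR; field; lra.
  - unfold hy; apply Rdiv_le_0_compat; lra.
  - pose proof (pow2_ge_0 (sigma - y)); lra. }
assert (HG : eval2 x z (quartic_weight_num r s k) =
             16 * IZR grid ^ 6 * quartic_weight rho sigma k0).
{ unfold quartic_weight_num; cbv zeta.
  rewrite !(ev_add _ _ Hev), !(ev_mul _ _ Hev), !(ev_add _ _ Hev), !(ev_mul _ _ Hev),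
    !(ev_add _ _ Hev), !(ev_mul _ _ Hev), !(ev_ofZ _ _ Hev), Hr, Hs, Hkk.
  rewrite !mult_IZR, (eq_sym (pow_IZR grid 2) : IZR (grid ^ 2) = IZR grid ^ 2),
    (eq_sym (pow_IZR grid 4) : IZR (grid ^ 4) = IZR grid ^ 4).
  unfold quartic_weight; field. }
unfold gap_num in Hgap'.
rewrite (ev_add _ _ Hev), !(ev_mul _ _ Hev), !(ev_ofZ _ _ Hev), Hr, HG in Hgap'.
rewrite opp_IZR, !mult_IZR, (eq_sym (pow_IZR grid 3) : IZR (grid ^ 3) = IZR grid ^ 3),
  (eq_sym (pow_IZR h_scale 7) : IZR (h_scale ^ 7) = IZR h_scale ^ 7) in Hgap'.
set (S := eval2 x z T) in *.
assert (Hnum : IZR kappa_num * quartic_weight rho sigma k0 * (IZR moment_scale * c)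
               <= IZR pi_num * (rho * S)).
{ apply Rmult_le_reg_l with (IZR grid); [exact Hg|]; unfold c.
  set (lo := IZR (low2 _)) in Hgap', Hgap; cbv zeta in Hgap'.
  replace (IZR grid * (IZR kappa_num * quartic_weight rho sigma k0 * (IZR moment_scale * (16 * IZR h_scale ^ 7 * IZR grid ^ 8))))
    with (IZR kappa_num * IZR moment_scale * IZR h_scale ^ 7 * IZR grid ^ 3 *
          (16 * IZR grid ^ 6 * quartic_weight rho sigma k0)) by ring.
  lra. }
apply Rle_trans with (rho * (PI * (S / IZR moment_scale) / c)); [|now apply Rmult_le_compat_l].
apply Rle_trans with (rho * (IZR pi_num / IZR const_den * (S / IZR moment_scale) / c)).
- unfold kappa; apply Rmult_le_reg_r with (IZR const_den * (IZR moment_scale * c));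
    [auto using Rmult_lt_0_compat|].
  replace (_ * (IZR const_den * (IZR moment_scale * c)))
    with (IZR kappa_num * quartic_weight rho sigma k0 * (IZR moment_scale * c)) by (field; lra).
  replace (_ * (IZR const_den * (IZR moment_scale * c)))
    with (IZR pi_num * (rho * S)) by (field; lra).
  exact Hnum.
(* Passing from PI to its rational lower bound is sound because [T] was checked to be
   nonnegative. *)
- unfold Rdiv at 1 3; apply Rmult_le_compat_l; [exact Hrho|].
  apply Rmult_le_compat_r; [left; now apply Rinv_0_lt_compat|].
  apply Rmult_le_compat_r; [|apply PI_bounds].
  apply Rdiv_le_0_compat; lra.
Qed.

(* On a leaf, [h] approximates [Q^(-1/2)] and [k] is affine in the coordinates of the box. *)
Inductive cover : Type :=
| Leaf (k0 k1 k2 : Z) (h : list Z)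
| SplitRho (m : Z) (l r : cover)
| SplitSigma (m : Z) (l r : cover).

Fixpoint cover_ok (a b c d : Z) (t : cover) : bool :=
  match t with
  | Leaf k0 k1 k2 h =>
      (a <? b)%Z && (c <? d)%Z && leaf_ok [[a; b - a]]%Z [[c]; [d - c]]%Z [[k0; k1]; [k2]] h
  | SplitRho m l r => cover_ok a m c d l && cover_ok m b c d r
  | SplitSigma m l r => cover_ok a b c m l && cover_ok a b m d r
  end.

Lemma cover_ok_spec t : forall a b c d rho sigma,
  cover_ok a b c d t = true -> 0 <= rho ->
  IZR a <= IZR grid * rho <= IZR b -> IZR c <= IZR grid * sigma <= IZR d ->
  exists k, 0 <= k /\ kappa * quartic_weight rho sigma k <= rho * weight_integral k sigma.
Proof.
induction t as [k0 k1 k2 h | m l IHl r IHr | m l IHl r IHr];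
  intros a b c d rho sigma Hok Hrho Hr Hs; cbn [cover_ok] in Hok;
  rewrite !Bool.andb_true_iff in Hok.
- destruct Hok as [[Hab Hcd] Hok].
  apply Z.ltb_lt, IZR_lt in Hab, Hcd.
  assert (Hunit : forall u v w, u < v -> u <= w <= v -> 0 <= (w - u) / (v - u) <= 1).
  { intros u v w Huv Hw; split; [apply Rdiv_le_0_compat; lra|].
    apply Rmult_le_reg_r with (v - u); [lra|].
    unfold Rdiv; rewrite Rmult_assoc, Rinv_l; lra. }
  apply (leaf_ok_spec _ _ _ _ ((IZR grid * rho - IZR a) / (IZR b - IZR a))
           ((IZR grid * sigma - IZR c) / (IZR d - IZR c)) rho sigma Hok); auto;
    unfold eval2; simpl; rewrite minus_IZR; field; lra.
- destruct Hok as [Hl Hr'].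
  destruct (Rle_lt_dec (IZR grid * rho) (IZR m));
    [apply (IHl a m c d) | apply (IHr m b c d)]; auto; lra.
- destruct Hok as [Hl Hr'].
  destruct (Rle_lt_dec (IZR grid * sigma) (IZR m));
    [apply (IHl a b c m) | apply (IHr a b m d)]; auto; lra.
Qed.

(** All entries are mere witnesses, validated leaf by leaf. The boxes are finest at sigma = 0 around
    rho = 25600 / [grid], about 1.56, which is the maximum of the extremal function normalised to
    mean square 1. *)
Definition critical_cover : cover :=
  (SplitRho 21299
    (SplitSigma 10076
      (SplitRho 20152
        (Leaf 62021 (-27304) 20672 [556; 0; -70])
        (SplitSigma 5038
          (Leaf 33465 (-15658) 3255 [809; 0; -189])
          (SplitRho 20725
            (Leaf 38847 (-15167) 19859 [636; 80; -84])
            (Leaf 28420 (-9543) 12186 [733; 113; -118]))))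
      (SplitRho 20152
        (Leaf 79601 (-9277) 9277 [423; 58; -21])
        (Leaf 63956 (-16192) 34746 [423; 58; -21])))
    (SplitRho 24576
      (SplitSigma 10076
        (SplitRho 22937
          (SplitSigma 5038
            (SplitRho 22118
              (Leaf 19514 (-5903) 1459 [1003; 0; -318])
              (Leaf 14092 (-3819) 814 [1172; 0; -452]))
            (SplitRho 22118
              (Leaf 21738 (-8460) 7300 [850; 158; -163])
              (Leaf 15313 (-5179) 4026 [984; 217; -220])))
          (SplitSigma 5038
            (SplitRho 23756
              (SplitSigma 2519
                (Leaf 10536 (-2503) 104 [1359; 0; -623])
                (Leaf 10697 (-2634) 351 [1288; 154; -518]))
              (SplitSigma 2519
                (SplitRho 24166
                  (Leaf 8104 (-966) 64 [1497; 0; -759])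
                  (Leaf 7151 (-823) 46 [1463; 0; -648; 0]))
                (Leaf 8173 (-1868) 189 [1396; 545; -562; -451])))
            (SplitRho 23756
              (Leaf 11224 (-3374) 2255 [1113; 280; -278])
              (Leaf 8471 (-2303) 1241 [1262; 782; -368; -553]))))
        (SplitSigma 15114
          (SplitRho 22937
            (Leaf 28016 0 0 [675; 168; -53])
            (SplitSigma 12595
              (SplitRho 23756
                (Leaf 14227 (-4937) 3329 [905; 319; -78])
                (Leaf 10146 (-3212) 1871 [1001; 423; -57]))
              (SplitRho 23756
                (Leaf 18730 (-8181) 8413 [759; 268; -23])
                (Leaf 12684 (-5049) 4789 [849; 378; 18]))))
          (SplitSigma 17633
            (SplitRho 22937
              (SplitRho 22118
                (Leaf 77650 (-17082) 17082 [418; 61; -18])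
                (Leaf 46570 (-18768) 34096 [498; 100; -22]))
              (SplitRho 23756
                (SplitSigma 16373
                  (Leaf 29574 (-13075) 9143 [640; 196; -15])
                  (Leaf 41850 (-20733) 17227 [553; 141; -16]))
                (SplitRho 24166
                  (Leaf 18387 (-5823) 16442 [666; 234; 3])
                  (Leaf 14857 (-4478) 12493 [708; 285; 23]))))
            (SplitRho 22937
              (Leaf 79565 (-9418) 9418 [407; 66; -13])
              (Leaf 58338 (-27530) 31374 [453; 90; -13])))))
      (SplitRho 26624
        (SplitSigma 10076
          (SplitSigma 5038
            (SplitSigma 2519
              (SplitRho 25600
                (SplitRho 25088
                  (SplitRho 24832
                    (Leaf 6340 (-453) 34 [1519; 0; -698; 0])
                    (Leaf 5891 (-413) 27 [1732; 0; -1801; 0; 992]))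
                  (SplitRho 25344
                    (SplitSigma 1259
                      (SplitRho 25216
                        (Leaf 5485 (-192) 5 [1597; 0; -768; 0])
                        (Leaf 5293 (-183) 5 [1816; 0; -2008; 0; 1133]))
                      (Leaf 5490 (-378) 15 [1604; 414; -766; -376]))
                    (SplitSigma 1259
                      (SplitRho 25472
                        (Leaf 5110 (-176) 4 [1785; 0; -1709; 0; 838; 0])
                        (SplitRho 25536
                          (Leaf 4935 (-85) 3 [1806; 0; -1752; 0; 863; 0])
                          (SplitRho 25568
                            (Leaf 4851 (-42) 3 [1816; 0; -1774; 0; 876; 0])
                            (SplitRho 25584
                              (Leaf 4809 (-21) 3 [1890; 0; -2767; 0; 3274; 0; -1514])
                              (SplitRho 25592
                                (Leaf 4788 (-10) 3 [1893; 0; -2778; 0; 3292; 0; -1523])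
                                (Leaf 4778 (-10) 3 [1895; 0; -2786; 0; 3303; 0; -1529]))))))
                      (Leaf 5114 (-346) 11 [1824; 310; -1942; -244; 1065]))))
                (SplitSigma 1259
                  (SplitRho 26112
                    (SplitRho 25856
                      (SplitRho 25728
                        (SplitRho 25664
                          (SplitRho 25632
                            (SplitRho 25616
                              (SplitRho 25608
                                (Leaf 4768 (-10) 3 [1897; 0; -2794; 0; 3315; 0; -1535])
                                (Leaf 4757 (-10) 3 [1899; 0; -2801; 0; 3327; 0; -1541]))
                              (Leaf 4747 (-20) 3 [1903; 0; -2813; 0; 3345; 0; -1550]))
                            (Leaf 4727 (-40) 3 [1837; 0; -1818; 0; 903; 0]))
                          (Leaf 4686 (-80) 3 [1921; 0; -2282; 0; 1323]))
                        (Leaf 4607 (-154) 2 [1946; 0; -2348; 0; 1369]))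
                      (Leaf 4452 (-290) 1 [1996; 0; -2483; 0; 1465]))
                    (Leaf 4159 (-513) 0 [2097; 0; -2768; 0; 1667]))
                  (Leaf 4750 (-1125) 4 [1980; 352; -2332; -284; 1330])))
              (SplitRho 25600
                (SplitRho 25088
                  (Leaf 6379 (-899) 105 [1515; 681; -661; -590])
                  (Leaf 5506 (-747) 62 [1689; 589; -1382; -455; 628]))
                (SplitRho 26112
                  (Leaf 4778 (-625) 30 [1793; 659; -1578; -521; 740])
                  (Leaf 4167 (-528) 7 [1897; 729; -1783; -588; 861]))))
            (SplitSigma 7557
              (SplitRho 25600
                (Leaf 6505 (-1777) 191 [1484; 1013; -569; -825])
                (Leaf 4818 (-1224) 54 [1611; 1092; -567; -841; -80]))
              (Leaf 6745 (-3407) 317 [1327; 527; -255])))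
          (SplitRho 25600
            (SplitSigma 15114
              (SplitSigma 12595
                (Leaf 7441 (-2594) 962 [1094; 553; -8])
                (Leaf 8886 (-3877) 2578 [935; 528; 103]))
              (Leaf 17243 0 0 [689; 295; 44]))
            (Leaf 5821 0 0 [932; 674; 259])))
        (SplitRho 32768
          (SplitSigma 10076
            (SplitSigma 5038
              (SplitSigma 2519
                (SplitRho 29696
                  (SplitRho 28160
                    (SplitRho 27392
                      (Leaf 3644 (-635) (-4) [2265; 0; -4953; 0; 9989; 0; -10527; 0; 4171])
                      (Leaf 3014 (-507) (-9) [2288; 0; -2843; 0; 1539; 0]))
                    (Leaf 2497 (-742) (-12) [2837; 0; -7294; 0; 10943; 0; -5596]))
                  (SplitRho 31232
                    (Leaf 1763 (-500) (-14) [2829; 0; -4212; 0; 2426; 0])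
                    (Leaf 1267 (-345) (-13) [3106; 0; -4952; 0; 2915; 0])))
                (SplitRho 29696
                  (SplitSigma 3778
                    (SplitRho 28160
                      (Leaf 3620 (-1153) (-8) [2181; 724; -2605; -605; 1445])
                      (Leaf 2485 (-745) (-16) [2527; 883; -3520; -764; 2072]))
                    (Leaf 3550 (-1919) (-13) [2165; 1141; -2062; -968; 920]))
                  (SplitRho 31232
                    (Leaf 1749 (-499) (-42) [2710; 1254; -3678; -1111; 2070])
                    (Leaf 1253 (-343) (-40) [2986; 1412; -4421; -1274; 2575]))))
              (SplitSigma 7557
                (SplitRho 29696
                  (SplitRho 28160
                    (Leaf 3628 (-1210) (-25) [1890; 2137; -1122; -3837; 262; 2072])
                    (Leaf 2456 (-762) (-66) [2170; 2978; -1503; -5825; 405; 3282]))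
                  (SplitRho 31232
                    (Leaf 1707 (-500) (-76) [2459; 3932; -1972; -8217; 618; 4784])
                    (Leaf 1205 (-331) (-67) [2757; 4974; -2532; -10949; 906; 6542])))
                (SplitRho 29696
                  (SplitRho 28160
                    (Leaf 3643 (-1305) (-16) [1495; 701; -254])
                    (Leaf 2402 (-792) (-99) [1604; 836; -229]))
                  (Leaf 1599 (-830) (-115) [1717; 1004; -173]))))
            (SplitSigma 15114
              (SplitSigma 12595
                (SplitRho 29696
                  (Leaf 3628 (-2359) 6 [1512; 1718; -47; -929])
                  (Leaf 1477 (-823) (-171) [1760; 2391; 106; -1250]))
                (Leaf 1237 0 0 [1152; 1805; 1336]))
              (Leaf 936 0 0 [834; 761; 1437; 1076])))
          (SplitRho 36864
            (SplitSigma 10076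
              (SplitSigma 5038
                (SplitSigma 2519
                  (Leaf 899 (-102) (-6) [3326; 0; -5555; 0; 3318; 0])
                  (Leaf 886 (-77) (-19) [3188; 3529; -4554; -7803; 2705; 4577; -264]))
                (SplitSigma 7557
                  (Leaf 855 (-29) (-29) [2938; 5626; -2905; -12708; 1112; 7690])
                  (Leaf 819 0 0 [1757; 1074; -143])))
              (SplitSigma 15114
                (SplitSigma 12595
                  (Leaf 819 0 0 [1408; 1710; 965])
                  (Leaf 819 0 0 [1171; 2290; 1875]))
                (Leaf 819 0 0 [932; 1624; 1331])))
            (SplitSigma 10076
              (SplitRho 49152
                (SplitSigma 5038
                  (SplitRho 43008
                    (SplitSigma 2519
                      (Leaf 819 0 0 [2552; 0; -1729; 0])
                      (Leaf 819 0 0 [3188; 3529; -4554; -7803; 2705; 4577; -264]))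
                    (SplitSigma 2519
                      (Leaf 819 0 0 [2552; 0; -1729; 0])
                      (Leaf 819 0 0 [3188; 3529; -4554; -7803; 2705; 4577; -264])))
                  (SplitRho 43008
                    (SplitSigma 7557
                      (Leaf 819 0 0 [2303; 2949; 292; -2723; -1648])
                      (Leaf 819 0 0 [1757; 1074; -143]))
                    (SplitSigma 7557
                      (Leaf 819 0 0 [2303; 2949; 292; -2723; -1648])
                      (Leaf 819 0 0 [1757; 1074; -143]))))
                (SplitSigma 5038
                  (SplitRho 55296
                    (SplitSigma 2519
                      (Leaf 819 0 0 [2552; 0; -1729; 0])
                      (Leaf 819 0 0 [3188; 3529; -4554; -7803; 2705; 4577; -264]))
                    (SplitSigma 2519
                      (Leaf 819 0 0 [2552; 0; -1729; 0])
                      (Leaf 819 0 0 [3188; 3529; -4554; -7803; 2705; 4577; -264])))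
                  (SplitRho 55296
                    (SplitSigma 7557
                      (Leaf 819 0 0 [2303; 2949; 292; -2723; -1648])
                      (Leaf 819 0 0 [1757; 1074; -143]))
                    (SplitSigma 7557
                      (Leaf 819 0 0 [2303; 2949; 292; -2723; -1648])
                      (Leaf 819 0 0 [1757; 1074; -143])))))
              (SplitRho 49152
                (SplitSigma 15114
                  (SplitRho 43008
                    (SplitSigma 12595
                      (Leaf 819 0 0 [1408; 1710; 965])
                      (Leaf 819 0 0 [1171; 2290; 1875]))
                    (SplitSigma 12595
                      (Leaf 819 0 0 [1408; 1710; 965])
                      (Leaf 819 0 0 [1171; 2290; 1875])))
                  (Leaf 819 0 0 [932; 1624; 1331]))
                (SplitSigma 15114
                  (SplitRho 55296
                    (SplitSigma 12595
                      (Leaf 819 0 0 [1408; 1710; 965])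
                      (Leaf 819 0 0 [1171; 2290; 1875]))
                    (SplitSigma 12595
                      (Leaf 819 0 0 [1408; 1710; 965])
                      (Leaf 819 0 0 [1171; 2290; 1875])))
                  (Leaf 819 0 0 [822; 755; 1552; 1193])))))))))%Z.

Lemma critical_cover_ok : cover_ok 19005 61440 0 20152 critical_cover = true.
Proof. vm_cast_no_check (eq_refl true). Qed.

Lemma weight_integral_rectangle rho sigma :
  1.16 <= rho <= 3.75 -> 0 <= sigma <= 1.2299 ->
  exists k, 0 <= k /\ kappa * quartic_weight rho sigma k <= rho * weight_integral k sigma.
Proof.
intros Hrho Hsigma.
apply (cover_ok_spec critical_cover 19005 61440 0 20152); [exact critical_cover_ok | | |];
  unfold grid; lra.
Qed.

(** * The integral of the square root of a quartic *)

(** For [k = a^2 - s^2] the square root lies above its tangent line at [y = 0], which is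
    [a - s / a * y]; its linear term integrates to 0 against the squared sine. *)
Lemma weight_integral_ge_linear a s :
  0 <= s <= a -> 0 < a -> PI / 2 * a <= weight_integral (a ^ 2 - s ^ 2) s.
Proof.
intros Hs Ha.
replace (PI / 2 * a) with (1 * (PI / 2 * a)) by ring.
apply weight_integral_ge with (fun y => a - s / a * y); [nra | |].
- intros y _; rewrite Rmult_1_l.
  replace (a ^ 2 - s ^ 2 + (s - y) ^ 2) with ((a - s / a * y) ^ 2 + (1 - (s / a) ^ 2) * y ^ 2)
    by (field; lra).
  assert (Hsa : 0 <= s / a <= 1).
  { split; [apply Rdiv_le_0_compat; lra|].
    apply Rmult_le_reg_r with a; [lra|]; unfold Rdiv; rewrite Rmult_assoc, Rinv_l; lra. }
  apply Rle_trans with (sqrt ((a - s / a * y) ^ 2)).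
  + rewrite <- Rsqr_pow2, sqrt_Rsqr_abs; apply Rle_abs.
  + apply sqrt_le_1_alt; set (c := s / a) in *.
    assert (0 <= (1 - c ^ 2) * y ^ 2) by (apply Rmult_le_pos; [nra | apply pow2_ge_0]); lra.
- replace (PI / 2 * a) with
    (minus (a * (PI / 2 - sin PI * cos PI / 2) - s / a * (sin PI ^ 3 / 3))
           (a * (0 / 2 - sin 0 * cos 0 / 2) - s / a * (sin 0 ^ 3 / 3)))
    by (rewrite sin_PI, sin_0; unfold minus, plus, opp; simpl; field; lra).
  apply (is_RInt_derive (fun t => a * (t / 2 - sin t * cos t / 2) - s / a * (sin t ^ 3 / 3))
           (fun t => sin t ^ 2 * (a - s / a * cos t))).
  + intros t _; auto_derive; [easy|].
    pose proof (sin2_cos2 t) as Hsc; rewrite !Rsqr_pow2 in Hsc.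
    match goal with |- ?l = ?r =>
      replace l with (a * (1 - cos t ^ 2 + sin t ^ 2) / 2 - s / a * (sin t ^ 2 * cos t))
        by (field; lra) end.
    replace (1 - cos t ^ 2) with (sin t ^ 2) by lra; field; lra.
  + intros t _; apply (ex_derive_continuous (fun t => sin t ^ 2 * (a - s / a * cos t))).
    now auto_derive.
Qed.

(** No cubic term is allowed, since the normalisation does not determine the mean of [u^3]. *)
Definition quartic (A B C v : R) : R := A + B * v + C * v ^ 2 - v ^ 4.

Lemma continuous_sqrt_quartic A B C v :
  0 <= quartic A B C v -> continuous (fun v => sqrt (quartic A B C v)) v.
Proof.
intros Hv; apply (continuous_comp (quartic A B C) sqrt).
- unfold quartic; apply (ex_derive_continuous (fun v => A + B * v + C * v ^ 2 - v ^ 4)).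
  now auto_derive.
- now apply continuity_pt_filterlim, continuity_pt_sqrt.
Qed.

(* If a function of mean 0 and mean square 1 has range [m,M], then [A + C - mean (u^4)] is
   the mean of [quartic A B C u]. *)
Definition calibrated (m M : R) : Prop :=
  exists A B C,
    (forall v, m <= v <= M -> 0 <= quartic A B C v) /\
    kappa * (A + C) <= RInt (fun v => sqrt (quartic A B C v)) m M.

Lemma ex_RInt_sqrt_quartic A B C m M :
  m <= M -> (forall v, m <= v <= M -> 0 <= quartic A B C v) ->
  ex_RInt (fun v => sqrt (quartic A B C v)) m M.
Proof.
intros HmM Hpos; apply (ex_RInt_continuous (V := R_CompleteNormedModule)).
intros v Hv; rewrite Rmin_left, Rmax_right in Hv by lra.
now apply continuous_sqrt_quartic, Hpos.
Qed.

(** The reflection [v -> - v] changes the sign of [B] only; this reduces the problem to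
    [0 <= m + M]. *)
Lemma calibrated_opp m M : m <= M -> calibrated (- M) (- m) -> calibrated m M.
Proof.
intros HmM (A & B & C & Hpos & Hle); exists A, (- B), C.
assert (Hq : forall v, quartic A (- B) C v = quartic A B C (- v)) by (intros; unfold quartic; ring).
assert (Hpos' : forall v, m <= v <= M -> 0 <= quartic A (- B) C v)
  by (intros v Hv; rewrite Hq; apply Hpos; lra).
split; [exact Hpos'|].
eapply Rle_trans; [exact Hle|]; apply Req_le.
assert (Hcomp : RInt (fun y => scal (- 1) (sqrt (quartic A B C (- y)))) m M
                = RInt (fun v => sqrt (quartic A B C v)) (- m) (- M)).
{ apply (RInt_comp (fun v => sqrt (quartic A B C v)) Ropp (fun _ => - 1)).
  - intros v Hv; rewrite Rmin_left, Rmax_right in Hv by lra.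
    apply continuous_sqrt_quartic, Hpos; lra.
  - intros v _; split; [auto_derive; [easy | ring] | apply continuous_const]. }
rewrite <- (opp_RInt_swap (V := R_CompleteNormedModule)), <- Hcomp.
- rewrite <- (RInt_opp (V := R_CompleteNormedModule)).
  + apply RInt_ext; intros v _; unfold opp, scal; simpl; unfold mult; simpl; rewrite Hq; ring.
  + apply ex_RInt_ext with (fun v => scal (- 1) (sqrt (quartic A (- B) C v))).
    * intros v _; now rewrite Hq.
    * now apply (ex_RInt_scal (V := R_NormedModule)), ex_RInt_sqrt_quartic.
- apply ex_RInt_swap, ex_RInt_sqrt_quartic; [lra | exact Hpos].
Qed.

(** Substituting [v = s / 2 - rho * cos t] with [s = m + M] turns the integral of the square root of
    the quartic into rho^3 J(k,sigma). *)
Lemma calibrated_weight_integral m M k :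
  m < M -> 0 <= k ->
  let rho := (M - m) / 2 in
  let sigma := (m + M) / rho in
  kappa * quartic_weight rho sigma k <= rho * weight_integral k sigma ->
  calibrated m M.
Proof.
intros HmM Hk rho sigma Hle.
assert (Hrho : 0 < rho) by (unfold rho; lra).
assert (Hs : m + M = rho * sigma) by (unfold sigma; field; lra).
assert (Hm : m = rho * sigma / 2 - rho) by (rewrite <- Hs; unfold rho; field).
assert (HM : M = rho * sigma / 2 + rho) by (rewrite <- Hs; unfold rho; field).
clearbody rho sigma; clear Hs; subst m M; clear HmM.
(* The quartic is the product of [n + s v - v^2 = (v - m) (M - v)] and
   [q + s v + v^2 = (v + s/2)^2 + rho^2 k]; the cubic terms cancel. *)
set (q := rho ^ 2 * (k + sigma ^ 2 / 4)); set (n := rho ^ 2 * (1 - sigma ^ 2 / 4)).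
set (s := rho * sigma).
exists (n * q), (s * (n + q)), (s ^ 2 + n - q).
assert (Hq : forall y, quartic (n * q) (s * (n + q)) (s ^ 2 + n - q) (s / 2 - rho * y)
               = (rho ^ 2) ^ 2 * (1 - y ^ 2) * (k + (sigma - y) ^ 2))
  by (intros y; unfold quartic, s, n, q; field).
assert (Hpos : forall y, -1 <= y <= 1 -> 0 <= (rho ^ 2) ^ 2 * (1 - y ^ 2) * (k + (sigma - y) ^ 2)).
{ intros y Hy; apply Rmult_le_pos; [apply Rmult_le_pos; [apply pow2_ge_0 | nra]|].
  pose proof (pow2_ge_0 (sigma - y)); lra. }
split.
- intros v Hv.
  set (y := (s / 2 - v) / rho).
  assert (Hy : rho * y = s / 2 - v) by (unfold y; field; lra).
  replace v with (s / 2 - rho * y) by (rewrite Hy; ring).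
  rewrite Hq; clearbody y; apply Hpos; split; apply Rmult_le_reg_l with rho; lra.
- apply Rle_trans with (rho ^ 3 * weight_integral k sigma).
  + replace (kappa * _) with (rho ^ 2 * (kappa * quartic_weight rho sigma k))
      by (unfold quartic_weight, s, n, q; field).
    replace (rho ^ 3 * _) with (rho ^ 2 * (rho * weight_integral k sigma)) by ring.
    apply Rmult_le_compat_l; [apply pow2_ge_0 | exact Hle].
  + apply Req_le.
    replace (s / 2 - rho) with (s / 2 - rho * cos 0) by (rewrite cos_0; ring).
    replace (s / 2 + rho) with (s / 2 - rho * cos PI) by (rewrite cos_PI; ring).
    set (P := quartic _ _ _) in *.
    rewrite <- (RInt_comp (fun v => sqrt (P v)) (fun t => s / 2 - rho * cos t) (fun t => rho * sin t)).
    * symmetry; apply is_RInt_unique.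
      change (rho ^ 3 * weight_integral k sigma) with (scal (rho ^ 3) (weight_integral k sigma)).
      eapply is_RInt_ext;
        [|apply (is_RInt_scal (V := R_NormedModule)), (is_RInt_weight_integral k sigma Hk)].
      intros t Ht; rewrite Rmin_left, Rmax_right in Ht by (pose proof PI_RGT_0; lra).
      assert (Hsin : 0 <= sin t) by (apply sin_ge_0; lra).
      rewrite Hq; unfold scal; cbn -[pow]; unfold mult; cbn -[pow].
      pose proof (sin2_cos2 t) as Hsc; rewrite !Rsqr_pow2 in Hsc.
      replace (1 - cos t ^ 2) with (sin t ^ 2) by lra.
      replace ((rho ^ 2) ^ 2 * sin t ^ 2) with ((rho ^ 2 * sin t) ^ 2) by ring.
      rewrite sqrt_mult, sqrt_pow2; [ring | | apply pow2_ge_0 |].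
      -- apply Rmult_le_pos; [apply pow2_ge_0 | easy].
      -- pose proof (pow2_ge_0 (sigma - cos t)); lra.
    * intros t _; apply continuous_sqrt_quartic; fold P; rewrite Hq; apply Hpos, COS_bound.
    * intros t _; split; [auto_derive; [easy | ring]|].
      apply (ex_derive_continuous (fun t => rho * sin t)); now auto_derive.
Qed.

Lemma kappa_bounds : 1.2411 < kappa < 1.2412.
Proof. unfold kappa, kappa_num, const_den; lra. Qed.

(** With the quartic [v^2 (M^2 - v^2)] the part over [0,M] alone contributes [M^3 / 3], which is at
    least [kappa * M^2] because 3.73 / 3 exceeds [kappa]. *)
Lemma calibrated_wide m M : m <= 0 -> 0 <= m + M -> 3.73 <= M -> calibrated m M.
Proof.
intros Hm Hs HM; exists 0, 0, (M ^ 2).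
assert (Hq : forall v, quartic 0 0 (M ^ 2) v = v ^ 2 * ((M - v) * (M + v)))
  by (intros; unfold quartic; ring).
assert (Hpos : forall v, m <= v <= M -> 0 <= quartic 0 0 (M ^ 2) v).
{ intros v Hv; rewrite Hq; apply Rmult_le_pos; [apply pow2_ge_0 | nra]. }
split; [exact Hpos|].
set (w := fun v => sqrt (quartic 0 0 (M ^ 2) v)).
assert (Hw : forall a b, m <= a <= b -> b <= M -> ex_RInt w a b)
  by (intros a b Ha Hb; apply ex_RInt_sqrt_quartic; [lra | intros; apply Hpos; lra]).
assert (Hhalf : RInt w 0 M = M ^ 3 / 3).
{ replace (RInt w 0 M) with (RInt w (- M * cos (PI / 2)) (- M * cos PI))
    by (rewrite cos_PI2, cos_PI; f_equal; ring).
  pose proof PI_RGT_0.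
  rewrite <- (RInt_comp w (fun t => - M * cos t) (fun t => M * sin t)).
  - apply is_RInt_unique.
    replace (M ^ 3 / 3) with (minus (- M ^ 3 / 3 * sin PI ^ 3) (- M ^ 3 / 3 * sin (PI / 2) ^ 3))
      by (rewrite sin_PI, sin_PI2; unfold minus, plus, opp; simpl; field).
    apply is_RInt_ext with (fun t => - M ^ 3 * sin t ^ 2 * cos t).
    + intros t Ht; rewrite Rmin_left, Rmax_right in Ht by lra.
      unfold w; rewrite Hq.
      pose proof (sin2_cos2 t) as Hsc; rewrite !Rsqr_pow2 in Hsc.
      replace ((- M * cos t) ^ 2 * ((M - - M * cos t) * (M + - M * cos t)))
        with ((M ^ 2 * (- cos t) * sin t) ^ 2)
        by (transitivity (M ^ 2 * cos t ^ 2 * (M ^ 2 * (1 - cos t ^ 2)));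
            [replace (1 - cos t ^ 2) with (sin t ^ 2) by lra; ring | ring]).
      rewrite sqrt_pow2; [unfold scal; simpl; unfold mult; simpl; ring|].
      pose proof (sin_ge_0 t ltac:(lra) ltac:(lra)); pose proof (cos_le_0 t ltac:(lra) ltac:(lra)).
      apply Rmult_le_pos; [apply Rmult_le_pos; [apply pow2_ge_0 | lra] | lra].
    + apply (is_RInt_derive (fun t => - M ^ 3 / 3 * sin t ^ 3) (fun t => - M ^ 3 * sin t ^ 2 * cos t)).
      * intros t _; auto_derive; [easy | simpl; field].
      * intros t _; apply (ex_derive_continuous (fun t => - M ^ 3 * sin t ^ 2 * cos t)).
        now auto_derive.
  - intros t Ht; rewrite Rmin_left, Rmax_right in Ht by lra.
    pose proof (cos_le_0 t ltac:(lra) ltac:(lra)); pose proof (COS_bound t).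
    apply continuous_sqrt_quartic, Hpos; nra.
  - intros t _; split; [auto_derive; [easy | ring]|].
    apply (ex_derive_continuous (fun t => M * sin t)); now auto_derive. }
change (kappa * (0 + M ^ 2) <= RInt w m M).
rewrite <- (RInt_Chasles (V := R_CompleteNormedModule) w m 0 M) by (apply Hw; lra).
assert (0 <= RInt w m 0)
  by (apply RInt_ge_0; [lra | apply Hw; lra | intros; apply sqrt_pos]).
change (kappa * (0 + M ^ 2) <= RInt w m 0 + RInt w 0 M); rewrite Hhalf.
pose proof kappa_bounds; pose proof (pow2_ge_0 M); simpl; simpl in *; nra.
Qed.

Lemma calibrated_of_nonneg_sum m M :
  m < 0 < M -> 1 <= - (m * M) -> 0 <= m + M -> calibrated m M.
Proof.
intros Hm Hn Hs.
destruct (Rle_lt_dec 3.73 M) as [HM|HM]; [apply calibrated_wide; lra|].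
(* In these terms [M = x + rho], [m = x - rho] and [- (m * M) = rho^2 - x^2]. *)
pose (rho := (M - m) / 2); pose (x := (m + M) / 2); pose (sigma := (m + M) / rho).
assert (Hrho : 0 < rho) by (unfold rho; lra).
assert (Hx : rho * sigma = 2 * x) by (unfold sigma, x; field; lra).
assert (Hsigma : 0 <= sigma) by (unfold sigma; apply Rdiv_le_0_compat; lra).
assert (Hx0 : 0 <= x) by (unfold x; lra).
assert (Hn' : - (m * M) = rho ^ 2 - x ^ 2) by (unfold rho, x; field).
assert (HrM : rho + x < 3.73) by (unfold rho, x; lra).
assert (Hcal : forall k, 0 <= k ->
   kappa * quartic_weight rho sigma k <= rho * weight_integral k sigma -> calibrated m M)
  by (intros k Hk Hle; apply (calibrated_weight_integral m M k); auto; lra).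
rewrite Hn' in Hn; clearbody rho x sigma.
clear Hm Hs HM Hn'.
assert (HG : forall k, rho ^ 2 * quartic_weight rho sigma k =
          (rho ^ 2 * k + x ^ 2) * (rho ^ 2 - x ^ 2 - 1) + rho ^ 2 + 3 * x ^ 2).
{ intros k; unfold quartic_weight.
  replace (x ^ 2) with ((rho * sigma) ^ 2 / 4) by (rewrite Hx; field); field. }
pose proof kappa_bounds as Hkappa.
assert (Hpi : 3.1415 < PI) by (pose proof PI_bounds; unfold pi_num, const_den in *; lra).
(* The tangent line bound with [k = a^2 - sigma^2], multiplied by [rho^2]; it suffices away from the
   critical rectangle. *)
assert (Hlin : forall a, 0 < a -> sigma <= a ->
   kappa * ((rho ^ 2 * a ^ 2 - 3 * x ^ 2) * (rho ^ 2 - x ^ 2 - 1) + rho ^ 2 + 3 * x ^ 2)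
     <= rho ^ 3 * (PI / 2 * a) -> calibrated m M).
{ intros a Ha Hsa Hle; apply (Hcal (a ^ 2 - sigma ^ 2)); [nra|].
  apply Rmult_le_reg_l with (rho ^ 2); [now apply pow_lt|].
  replace (rho ^ 2 * (kappa * quartic_weight rho sigma (a ^ 2 - sigma ^ 2)))
    with (kappa * (rho ^ 2 * quartic_weight rho sigma (a ^ 2 - sigma ^ 2))) by ring.
  rewrite HG.
  replace (rho ^ 2 * (a ^ 2 - sigma ^ 2) + x ^ 2) with (rho ^ 2 * a ^ 2 - 3 * x ^ 2)
    by (replace (x ^ 2) with ((rho * sigma) ^ 2 / 4) by (rewrite Hx; field); field).
  eapply Rle_trans; [exact Hle|].
  replace (rho ^ 2 * (rho * weight_integral (a ^ 2 - sigma ^ 2) sigma))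
    with (rho ^ 3 * weight_integral (a ^ 2 - sigma ^ 2) sigma) by ring.
  apply Rmult_le_compat_l; [apply pow_le; lra|].
  now apply weight_integral_ge_linear. }
destruct (Rle_lt_dec (rho ^ 2 - x ^ 2) 1.35) as [Hn1|Hn1].
(* Taking [a] proportional to [rho] makes both sides polynomials in [rho^2] and [x^2]; [sigma <= a]
   follows from [2 x <= 1 + x^2 <= rho^2]. *)
{ apply (Hlin (1.807 * rho)); [lra | nra |].
  replace ((1.807 * rho) ^ 2) with (3.265249 * rho ^ 2) by lra.
  replace (rho ^ 3 * (PI / 2 * (1.807 * rho))) with (PI * (0.9035 * (rho ^ 2) ^ 2)) by lra.
  set (R2 := rho ^ 2) in *; set (X := x ^ 2) in *.
  assert (HX : 0 <= X) by apply pow2_ge_0.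
  clearbody R2 X; clear - Hn Hn1 HX Hkappa Hpi.
  set (u := R2 * (3.265249 * R2) - 3 * X).
  assert (Hu : 0 <= u) by (unfold u; nra).
  assert (Hun : u * (R2 - X - 1) <= u * 0.35) by (apply Rmult_le_compat_l; lra).
  apply Rle_trans with (1.2412 * (u * 0.35 + R2 + 3 * X)).
  { apply Rmult_le_compat; try lra.
    assert (0 <= u * (R2 - X - 1)) by (apply Rmult_le_pos; lra); lra. }
  apply Rle_trans with (3.1415 * (0.9035 * R2 ^ 2)).
  { unfold u; assert (Hd : 0 <= R2 - X - 1) by lra.
    replace R2 with (1 + X + (R2 - X - 1)) by ring; set (d := R2 - X - 1) in *.
    (* At [d = 0] the difference of the two sides is a quadratic in [X] with its minimum near
       0.29. *)
    pose proof (pow2_ge_0 (X - 0.29)); pose proof (Rmult_le_pos _ _ Hd HX); nra. }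
  apply Rmult_le_compat_r; [apply Rmult_le_pos; [lra | apply pow2_ge_0] | lra]. }
destruct (Rle_lt_dec 0.9 x) as [Hx1|Hx1].
(* This is the choice [k = 0]: the other factor of the quartic becomes a square. *)
{ apply (Hlin sigma); [nra | lra |].
  replace (rho ^ 2 * sigma ^ 2) with (4 * x ^ 2)
    by (replace (rho ^ 2 * sigma ^ 2) with ((rho * sigma) ^ 2) by ring; rewrite Hx; ring).
  replace (rho ^ 3 * (PI / 2 * sigma)) with (rho ^ 2 * (PI / 2 * (rho * sigma))) by ring.
  rewrite Hx.
  assert (Hx2 : x < 1.87) by nra.
  set (n := rho ^ 2 - x ^ 2) in *.
  replace (rho ^ 2) with (n + x ^ 2) by (unfold n; ring).
  clearbody n.
  replace ((4 * x ^ 2 - 3 * x ^ 2) * (n - 1) + (n + x ^ 2) + 3 * x ^ 2)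
    with (n * (1 + x ^ 2) + 3 * x ^ 2) by ring.
  pose proof (pow2_ge_0 x) as HX.
  apply Rle_trans with (1.2412 * (n * (1 + x ^ 2) + 3 * x ^ 2)).
  { apply Rmult_le_compat_r; [|lra].
    apply Rplus_le_le_0_compat; [apply Rmult_le_pos; lra | lra]. }
  apply Rle_trans with (3.1415 * (x * (n + x ^ 2))).
  2:{ replace ((n + x ^ 2) * (PI / 2 * (2 * x))) with (PI * (x * (n + x ^ 2))) by field.
      apply Rmult_le_compat_r; [apply Rmult_le_pos; lra | lra]. }
  (* The remaining inequality is affine in [n]: [Hc] says that its slope is nonnegative, and [H1]
     settles the endpoint [n = 1.35]. *)
  assert (Hc : 0 <= 3.1415 * x - 1.2412 * (1 + x ^ 2)) by nra.
  assert (H1 : 1.35 * (3.1415 * x - 1.2412 * (1 + x ^ 2)) >= 3.7236 * x ^ 2 - 3.1415 * x ^ 3).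
  { assert (0 <= (x - 0.9) * (3.1415 * x ^ 2 - 2.5718 * x + 1.9256))
      by (apply Rmult_le_pos; nra).
    nra. }
  nra. }
(* From [x < 0.9] and [rho^2 - x^2 > 1.35] it follows that [sigma^2 = 4 x^2 / rho^2] is below 3.24 /
   2.16 = 1.5. *)
destruct (weight_integral_rectangle rho sigma) as (k & Hk & Hle); [| | now apply (Hcal k)].
- split; nra.
- split; [lra|].
  assert (sigma ^ 2 <= 1.51).
  { apply Rmult_le_reg_l with (rho ^ 2); [nra|].
    replace (rho ^ 2 * sigma ^ 2) with (4 * x ^ 2)
      by (replace (rho ^ 2 * sigma ^ 2) with ((rho * sigma) ^ 2) by ring; rewrite Hx; ring).
    nra. }
  nra.
Qed.

Lemma calibrated_of_range m M : m < 0 < M -> 1 <= - (m * M) -> calibrated m M.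
Proof.
intros Hm Hn; destruct (Rle_lt_dec 0 (m + M)).
- now apply calibrated_of_nonneg_sum.
- apply calibrated_opp; [lra|]; apply calibrated_of_nonneg_sum; lra.
Qed.

(** * The inequality *)

(** Derivatives are two-sided here even at 0 and [L]; test functions reach this form through their
    extension by constants. *)
Definition C1_on (L : R) (u u1 : R -> R) : Prop :=
  forall x, 0 <= x <= L -> is_derive u x (u1 x) /\ continuous u1 x.

Lemma C1_on_continuous L (u u1 : R -> R) x : C1_on L u u1 -> 0 <= x <= L -> continuous u x.
Proof.
intros Hu Hx; apply (ex_derive_continuous u); exists (u1 x); now apply Hu.
Qed.

Lemma ex_RInt_continuous_on (f : R -> R) L a b :
  (forall x, 0 <= x <= L -> continuous f x) -> 0 <= a <= L -> 0 <= b <= L -> ex_RInt f a b.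
Proof.
intros Hf Ha Hb; apply (ex_RInt_continuous (V := R_CompleteNormedModule)).
intros x Hx; apply Hf; revert Hx; unfold Rmin, Rmax; destruct (Rle_dec a b); lra.
Qed.

Lemma continuous_pow (f : R -> R) n x : continuous f x -> continuous (fun t => f t ^ n) x.
Proof.
intros Hf; apply (continuous_comp f (fun y => y ^ n)); [exact Hf|].
apply (ex_derive_continuous (fun y => y ^ n)); now auto_derive.
Qed.

Lemma RInt_le_subinterval (g : R -> R) L a b :
  0 <= a <= b -> b <= L ->
  (forall x, 0 <= x <= L -> continuous g x) -> (forall x, 0 <= x <= L -> 0 <= g x) ->
  RInt g a b <= RInt g 0 L.
Proof.
intros Ha Hb Hc Hg.
assert (Hex : forall c d, 0 <= c <= L -> 0 <= d <= L -> ex_RInt g c d)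
  by (intros; now apply ex_RInt_continuous_on with L).
rewrite <- (RInt_Chasles (V := R_CompleteNormedModule) g 0 a L) by (apply Hex; lra).
rewrite <- (RInt_Chasles (V := R_CompleteNormedModule) g a b L) by (apply Hex; lra).
assert (0 <= RInt g 0 a) by (apply RInt_ge_0; [lra | apply Hex; lra | intros; apply Hg; lra]).
assert (0 <= RInt g b L) by (apply RInt_ge_0; [lra | apply Hex; lra | intros; apply Hg; lra]).
change (RInt g a b <= RInt g 0 a + (RInt g a b + RInt g b L)); lra.
Qed.

(** Between a minimum point and a maximum point the substitution [v = u s] already produces the full
    integral over [[m,M]]; the rest of [[0,L]] only adds a nonnegative amount. *)
Lemma normalized_inequality L (u u1 : R -> R) :
  0 < L -> C1_on L u u1 -> RInt u 0 L = 0 -> RInt (fun s => u s ^ 2) 0 L = L ->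
  4 * kappa ^ 2 * RInt (fun s => u s ^ 4) 0 L <= L ^ 2 * RInt (fun s => u1 s ^ 2) 0 L.
Proof.
intros HL Hu Hmean Hsq.
assert (Hc : forall x, 0 <= x <= L -> continuous u x)
  by (intros x Hx; now apply C1_on_continuous with L u1).
assert (Hpt : forall x, 0 <= x <= L -> continuity_pt u x)
  by (intros x Hx; now apply continuity_pt_filterlim, Hc).
destruct (continuity_ab_min u 0 L ltac:(lra) Hpt) as [xm [Hmin Hxm]].
destruct (continuity_ab_maj u 0 L ltac:(lra) Hpt) as [xM [Hmax HxM]].
set (m := u xm) in *; set (M := u xM) in *.
assert (Hpow : forall n, ex_RInt (fun s => u s ^ n) 0 L).
{ intros n; apply ex_RInt_continuous_on with L; try lra.
  intros x Hx; now apply continuous_pow, Hc. }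
assert (Hpow1 : ex_RInt (fun s => u1 s ^ 2) 0 L).
{ apply ex_RInt_continuous_on with L; try lra.
  intros x Hx; now apply continuous_pow, Hu. }
assert (Hpoly : forall a b c d,
   is_RInt (fun s => a + b * u s + c * u s ^ 2 + d * u s ^ 4) 0 L
     ((a + c) * L + d * RInt (fun s => u s ^ 4) 0 L)).
{ intros a b c d.
  assert (H1 := RInt_correct (V := R_CompleteNormedModule) _ _ _ (Hpow 1%nat)).
  assert (H2 := RInt_correct (V := R_CompleteNormedModule) _ _ _ (Hpow 2%nat)).
  assert (H4 := RInt_correct (V := R_CompleteNormedModule) _ _ _ (Hpow 4%nat)).
  rewrite Hsq in H2.
  rewrite (RInt_ext _ u), Hmean in H1 by (intros; simpl; ring).
  pose proof (is_RInt_plus (V := R_NormedModule) _ _ _ _ _ _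
    (is_RInt_plus (V := R_NormedModule) _ _ _ _ _ _
      (is_RInt_plus (V := R_NormedModule) _ _ _ _ _ _
        (is_RInt_const (V := R_NormedModule) 0 L a)
        (is_RInt_scal (V := R_NormedModule) _ _ _ b _ H1))
      (is_RInt_scal (V := R_NormedModule) _ _ _ c _ H2))
    (is_RInt_scal (V := R_NormedModule) _ _ _ d _ H4)) as H.
  replace ((a + c) * L + _) with (plus (plus (plus (scal (L - 0) a) (scal b 0)) (scal c L))
     (scal d (RInt (fun s => u s ^ 4) 0 L)))
    by (unfold plus, scal; simpl; unfold mult; simpl; ring).
  eapply is_RInt_ext; [|exact H].
  intros x _; unfold plus, scal; simpl; unfold mult; simpl; ring. }
(* The function [(u - m) (M - u)] is nonnegative and has mean [- (m * M) - 1]. *)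
assert (HmM : m < 0 < M /\ 1 <= - (m * M)).
{ assert (Hp := Hpoly (- (m * M)) (m + M) (- 1) 0).
  assert (H0 : 0 <= (- (m * M) + - 1) * L + 0 * RInt (fun s => u s ^ 4) 0 L).
  { refine (is_RInt_le (fun _ => 0) _ 0 L 0 _ (Rlt_le _ _ HL) _ Hp _).
    - apply is_RInt_zero.
    - intros x Hx; pose proof (Hmin x ltac:(lra)); pose proof (Hmax x ltac:(lra)).
      replace (_ + _) with ((u x - m) * (M - u x)) by ring.
      apply Rmult_le_pos; lra. }
  assert (Hn : 1 <= - (m * M)) by nra.
  pose proof (Hmin xM HxM) as Hle; fold M in Hle.
  split; [nra | exact Hn]. }
destruct (calibrated_of_range m M (proj1 HmM) (proj2 HmM)) as (A & B & C & Hpos & Hcal).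
set (P := quartic A B C) in *; set (w := fun v => sqrt (P v)) in *.
(* For this value the terms containing [A + C] cancel in the final comparison. *)
set (t := 2 * kappa / L).
assert (Hk : 0 < kappa) by (pose proof kappa_bounds; lra).
assert (Ht : 0 < t) by (apply Rdiv_lt_0_compat; lra).
assert (Hrange : forall x, 0 <= x <= L -> m <= u x <= M) by (intros; split; auto).
set (g := fun s => u1 s ^ 2 + t ^ 2 * P (u s)).
assert (Hg : is_RInt g 0 L (RInt (fun s => u1 s ^ 2) 0 L
               + t ^ 2 * ((A + C) * L - RInt (fun s => u s ^ 4) 0 L))).
{ pose proof (is_RInt_plus (V := R_NormedModule) _ _ _ _ _ _
    (RInt_correct (V := R_CompleteNormedModule) _ _ _ Hpow1)
    (is_RInt_scal (V := R_NormedModule) _ _ _ (t ^ 2) _ (Hpoly A B C (- 1)))) as H.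
  replace (_ + _) with (plus (RInt (fun s => u1 s ^ 2) 0 L)
    (scal (t ^ 2) ((A + C) * L + - 1 * RInt (fun s => u s ^ 4) 0 L)))
    by (unfold plus, scal; simpl; unfold mult; simpl; ring).
  eapply is_RInt_ext; [|exact H].
  intros x _; unfold g, P, quartic, plus, scal; simpl; unfold mult; simpl; ring. }
assert (Hgc : forall x, 0 <= x <= L -> continuous g x).
{ intros x Hx; apply (continuous_plus (fun s => u1 s ^ 2)).
  - now apply continuous_pow, Hu.
  - apply (continuous_comp u (fun v => t ^ 2 * P v)); [now apply Hc|].
    apply (ex_derive_continuous (fun v => t ^ 2 * (A + B * v + C * v ^ 2 - v ^ 4))).
    now auto_derive. }
(* The square of [e * u1 - t * w] is expanded; the sign [e] accounts for the order of the minimum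
   and the maximum point. *)
assert (Hgw : forall e x, e ^ 2 = 1 -> 0 <= x <= L -> 2 * t * e * (u1 x * w (u x)) <= g x).
{ intros e x He Hx; unfold g.
  assert (HP : P (u x) = w (u x) ^ 2)
    by (unfold w; rewrite <- Rsqr_pow2, Rsqr_sqrt; auto).
  rewrite HP; pose proof (pow2_ge_0 (e * u1 x - t * w (u x))).
  replace (u1 x ^ 2) with ((e * u1 x) ^ 2) by (rewrite Rpow_mult_distr, He; ring).
  lra. }
assert (Hg0 : forall x, 0 <= x <= L -> 0 <= g x).
{ intros x Hx; pose proof (Hgw 1 x ltac:(ring) Hx); pose proof (Hgw (-1) x ltac:(ring) Hx); lra. }
assert (Hsub : forall a b, 0 <= a <= L -> 0 <= b <= L ->
  is_RInt (fun s => u1 s * w (u s)) a b (RInt w (u a) (u b))).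
{ intros a b Ha Hb.
  assert (Hin : forall x, Rmin a b <= x <= Rmax a b -> 0 <= x <= L)
    by (intros x; unfold Rmin, Rmax; destruct (Rle_dec a b); lra).
  apply (is_RInt_comp w u u1); intros x Hx; specialize (Hin x Hx).
  - now apply continuous_sqrt_quartic, Hpos, Hrange.
  - now apply Hu. }
assert (Hmain : 2 * t * RInt w m M <= RInt g 0 L).
{ assert (Hstep : forall e a b, e ^ 2 = 1 -> 0 <= a <= b -> b <= L ->
            2 * t * e * RInt w (u a) (u b) <= RInt g 0 L).
  { intros e a b He Ha Hb.
    apply Rle_trans with (RInt g a b); [|now apply RInt_le_subinterval].
    apply (is_RInt_le (fun s => 2 * t * e * (u1 s * w (u s))) g a b); [lra | | |].
    - now apply (is_RInt_scal (V := R_NormedModule) _ _ _ (2 * t * e)), Hsub; lra.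
    - apply (RInt_correct (V := R_CompleteNormedModule)), ex_RInt_continuous_on with L; auto; lra.
    - intros x Hx; apply Hgw; [exact He | lra]. }
  destruct (Rle_lt_dec xm xM) as [Hx|Hx].
  - pose proof (Hstep 1 xm xM ltac:(ring) ltac:(lra) ltac:(lra)) as H.
    fold m M in H; lra.
  - pose proof (Hstep (-1) xM xm ltac:(ring) ltac:(lra) ltac:(lra)) as H.
    fold m M in H.
    rewrite <- (opp_RInt_swap (V := R_CompleteNormedModule)) in H
      by (apply ex_RInt_sqrt_quartic; [lra | exact Hpos]).
    unfold opp in H; simpl in H; lra. }
rewrite (is_RInt_unique _ _ _ _ Hg) in Hmain.
assert (Hfin : 2 * t * (kappa * (A + C)) <= 2 * t * RInt w m M)
  by (apply Rmult_le_compat_l; [lra | exact Hcal]).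
set (I4 := RInt (fun s => u s ^ 4) 0 L) in *; set (D1 := RInt (fun s => u1 s ^ 2) 0 L) in *.
assert (H : L ^ 2 * (2 * t * (kappa * (A + C))) <= L ^ 2 * (D1 + t ^ 2 * ((A + C) * L - I4)))
  by (apply Rmult_le_compat_l; [apply pow2_ge_0 | lra]).
replace (L ^ 2 * (2 * t * (kappa * (A + C)))) with (4 * kappa ^ 2 * (A + C) * L) in H
  by (unfold t; field; lra).
replace (L ^ 2 * (D1 + t ^ 2 * ((A + C) * L - I4)))
  with (L ^ 2 * D1 + 4 * kappa ^ 2 * (A + C) * L - 4 * kappa ^ 2 * I4) in H
  by (unfold t; field; lra).
lra.
Qed.

Lemma RInt_pow_scal (f : R -> R) c n L :
  (forall x, 0 <= x <= L -> continuous f x) -> 0 < L ->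
  RInt (fun s => (c * f s) ^ n) 0 L = c ^ n * RInt (fun s => f s ^ n) 0 L.
Proof.
intros Hf HL; transitivity (RInt (fun s => scal (c ^ n) (f s ^ n)) 0 L).
- apply RInt_ext; intros x _; apply Rpow_mult_distr.
- apply (RInt_scal (V := R_CompleteNormedModule)), ex_RInt_continuous_on with L; try lra.
  intros x Hx; now apply continuous_pow, Hf.
Qed.

Lemma RInt_pow2_nonneg (f : R -> R) L :
  (forall x, 0 <= x <= L -> continuous f x) -> 0 < L -> 0 <= RInt (fun s => f s ^ 2) 0 L.
Proof.
intros Hf HL; apply RInt_ge_0; [lra | | intros; apply pow2_ge_0].
apply ex_RInt_continuous_on with L; try lra; intros x Hx; now apply continuous_pow, Hf.
Qed.

(** Both sides are homogeneous of degree 4 in [u], so [u] may be rescaled to mean square 1 unless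
    its square integral vanishes. *)
Lemma C1_inequality L (u u1 : R -> R) :
  0 < L -> C1_on L u u1 -> RInt u 0 L = 0 -> inequality (1 / (4 * kappa ^ 2)) L u u1.
Proof.
intros HL Hu Hmean; unfold inequality.
assert (Hc : forall x, 0 <= x <= L -> continuous u x)
  by (intros x Hx; now apply C1_on_continuous with L u1).
assert (Hc1 : forall x, 0 <= x <= L -> continuous u1 x) by (intros x Hx; now apply Hu).
assert (Hk : 0 < kappa) by (pose proof kappa_bounds; lra).
assert (Ha := RInt_pow2_nonneg u L Hc HL).
set (a := RInt (fun s => u s ^ 2) 0 L) in *.
set (I4 := RInt (fun s => u s ^ 4) 0 L); set (D := RInt (fun s => u1 s ^ 2) 0 L).
destruct (Rle_lt_dec a 0) as [Ha0|Ha0].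
- replace a with 0 by lra.
  assert (Hpt : forall x, 0 <= x <= L -> continuity_pt (fun s => u s ^ 2) x)
    by (intros x Hx; now apply continuity_pt_filterlim, continuous_pow, Hc).
  destruct (continuity_ab_maj _ 0 L ltac:(lra) Hpt) as [x0 [Hmax _]].
  set (K := u x0 ^ 2) in *.
  assert (Hex : forall n, ex_RInt (fun s => u s ^ n) 0 L).
  { intros n; apply ex_RInt_continuous_on with L; try lra.
    intros x Hx; now apply continuous_pow, Hc. }
  (* In the degenerate case [u^4 <= K u^2] forces the left side to be at most 0. *)
  assert (H : I4 <= K * a).
  { apply (is_RInt_le (fun s => u s ^ 4) (fun s => scal K (u s ^ 2)) 0 L); [lra | | |].
    - apply (RInt_correct (V := R_CompleteNormedModule)), Hex.
    - apply (is_RInt_scal (V := R_NormedModule)), (RInt_correct (V := R_CompleteNormedModule)), Hex.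
    - intros x Hx; replace (u x ^ 4) with (u x ^ 2 * u x ^ 2) by ring.
      apply Rmult_le_compat_r; [apply pow2_ge_0 | apply Hmax; lra]. }
  replace a with 0 in H by lra; lra.
- set (c := sqrt (L / a)).
  assert (Hc2 : c ^ 2 = L / a).
  { unfold c; rewrite <- Rsqr_pow2; apply Rsqr_sqrt, Rdiv_le_0_compat; lra. }
  assert (Hn : 4 * kappa ^ 2 * (c ^ 4 * I4) <= L ^ 2 * (c ^ 2 * D)).
  { unfold I4, D; rewrite <- !RInt_pow_scal by auto.
    apply (normalized_inequality L (fun s => c * u s) (fun s => c * u1 s)); [exact HL | | |].
    - intros x Hx; split.
      + apply (is_derive_scal u), Hu, Hx.
      + apply (continuous_comp u1 (fun y => c * y)); [now apply Hc1|].
        apply (ex_derive_continuous (fun y => c * y)); now auto_derive.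
    - rewrite (RInt_ext _ (fun s => (c * u s) ^ 1)) by (intros; symmetry; apply pow_1).
      rewrite RInt_pow_scal by auto.
      rewrite (RInt_ext _ u) by (intros; apply pow_1); rewrite Hmean; apply Rmult_0_r.
    - rewrite RInt_pow_scal, Hc2 by auto.
      change (L / a * a = L); field; lra. }
  replace (c ^ 4) with (c ^ 2 * c ^ 2) in Hn by ring.
  rewrite Hc2 in Hn.
  apply Rmult_le_reg_l with (4 * kappa ^ 2 * (L / a * (L / a))).
  { assert (0 < L / a) by (apply Rdiv_lt_0_compat; lra).
    assert (0 < kappa ^ 2) by (apply pow_lt; lra).
    apply Rmult_lt_0_compat; [lra | now apply Rmult_lt_0_compat]. }
  replace (4 * kappa ^ 2 * (L / a * (L / a)) * (1 / (4 * kappa ^ 2) * L * a * D))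
    with (L ^ 2 * (L / a * D)) by (field; lra).
  lra.
Qed.

(** * Extension of test functions to the real line *)

Definition clamp (L x : R) : R := Rmax 0 (Rmin L x).

Lemma clamp_id L x : 0 <= x <= L -> clamp L x = x.
Proof. intros Hx; unfold clamp; rewrite Rmin_right, Rmax_right; lra. Qed.

Lemma clamp_cases L y :
  0 < L -> y <= 0 /\ clamp L y = 0 \/ 0 <= y <= L /\ clamp L y = y \/ L <= y /\ clamp L y = L.
Proof. unfold clamp, Rmax, Rmin; intros HL; repeat destruct Rle_dec; lra. Qed.

(* The boundary conditions make the extension by constants continuously differentiable. *)
Lemma test_function_clamp L u u1 :
  0 < L -> test_function L u u1 ->
  C1_on L (fun x => u (clamp L x)) (fun x => u1 (clamp L x)).
Proof.
intros HL [[Hu [u2 [Hu1 _]]] [H0 [HL1 _]]] x Hx; split.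
- apply is_derive_Reals; intros eps Heps; rewrite (clamp_id L x Hx).
  destruct (Hu x Hx eps Heps) as (d & Hd & Hlim); cbn in Hlim; unfold Rdist in Hlim.
  (* Within distance [r] of [x] the segment can be left through an endpoint only if [x] is that
     endpoint. *)
  assert (Hmargin : exists r, 0 < r /\ (x = 0 \/ r <= x) /\ (x = L \/ r <= L - x)).
  { destruct (Req_dec x 0) as [->|Hx0]; [exists L; lra|].
    destruct (Req_dec x L) as [->|HxL]; [exists L; lra|].
    exists (Rmin x (L - x)); unfold Rmin; destruct Rle_dec; lra. }
  destruct Hmargin as (r & Hr & Hr0 & HrL).
  assert (Hdr : 0 < Rmin d r) by (apply Rmin_pos; lra).
  exists (mkposreal _ Hdr); intros h Hh Hhd; cbn in Hhd.
  pose proof (Rmin_l d r); pose proof (Rmin_r d r).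
  assert (Hhr : - r < h < r) by (apply Rabs_def2 in Hhd; lra).
  destruct (clamp_cases L (x + h) HL) as [[Hy ->] | [[Hy ->] | [Hy ->]]].
  + replace x with 0 by (destruct Hr0; lra).
    rewrite H0; replace ((u 0 - u 0) / h - 0) with 0 by (unfold Rdiv; ring).
    now rewrite Rabs_R0.
  + specialize (Hlim (x + h)).
    replace (x + h - x) with h in Hlim by ring.
    apply Hlim; split; [split; [exact Hy | lra] | lra].
  + replace x with L by (destruct HrL; lra).
    rewrite HL1; replace ((u L - u L) / h - 0) with 0 by (unfold Rdiv; ring).
    now rewrite Rabs_R0.
- apply continuity_pt_filterlim; intros eps Heps.
  destruct (cont_deriv _ _ _ _ (Hu1 x Hx) eps Heps) as (d & Hd & Hlim).
  exists d; split; [exact Hd|]; intros y [_ Hy]; cbn in *; unfold Rdist in *.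
  rewrite (clamp_id L x Hx).
  destruct (Req_dec (clamp L y) x) as [->|Hne].
  + now rewrite Rminus_diag, Rabs_R0.
  + apply Hlim; split.
    * split; [|lra]; unfold segment.
      destruct (clamp_cases L y HL) as [[? ->] | [[? ->] | [? ->]]]; lra.
    (* Clamping is 1-Lipschitz and fixes [x]. *)
    * apply Rle_lt_trans with (2 := Hy).
      destruct (clamp_cases L y HL) as [[? ->] | [[? ->] | [? ->]]];
        unfold Rabs; repeat destruct Rcase_abs; lra.
Qed.

Lemma RInt_clamp (f : R -> R) (phi : R -> R) L :
  0 < L -> RInt (fun s => phi (f (clamp L s))) 0 L = RInt (fun s => phi (f s)) 0 L.
Proof.
intros HL; apply RInt_ext; intros x Hx.
rewrite Rmin_left, Rmax_right in Hx by lra; rewrite clamp_id; [easy | lra].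
Qed.

Lemma admissible_kappa : admissible (1 / (4 * kappa ^ 2)).
Proof.
intros L u u1 HL Ht.
assert (HC1 := test_function_clamp L u u1 HL Ht).
destruct Ht as (_ & _ & _ & Hmean).
assert (H := C1_inequality L _ _ HL HC1).
unfold inequality in *.
rewrite (RInt_clamp u (fun y => y) L HL), (RInt_clamp u (fun y => y ^ 2) L HL),
  (RInt_clamp u (fun y => y ^ 4) L HL), (RInt_clamp u1 (fun y => y ^ 2) L HL) in H.
now apply H.
Qed.

(** This sign makes the set of valid constants for a single function closed upwards, as required
    when passing to the infimum. *)
Lemma inequality_rhs_nonneg L u u1 :
  0 < L -> test_function L u u1 ->
  0 <= L * RInt (fun s => u s ^ 2) 0 L * RInt (fun s => u1 s ^ 2) 0 L.
Proof.
intros HL Ht; assert (HC1 := test_function_clamp L u u1 HL Ht).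
rewrite <- (RInt_clamp u (fun y => y ^ 2) L HL), <- (RInt_clamp u1 (fun y => y ^ 2) L HL).
repeat apply Rmult_le_pos; try lra; apply RInt_pow2_nonneg; auto; intros x Hx.
- apply (C1_on_continuous _ _ _ _ HC1 Hx).
- apply HC1, Hx.
Qed.

(** * A function near the extremal one *)

Lemma RInt_cos_poly p :
  (length p <= length moments)%nat ->
  RInt (fun t => peval IZR p (cos t)) 0 PI = PI * (IZR (dot Z_ops p moments) / IZR moment_scale).
Proof.
intros Hp; apply is_RInt_unique.
eapply is_RInt_ext; [|apply (dot_is_RInt Z_ops _ _ _ p _ 0 Z_eval moments_spec Hp)].
intros t _; simpl; ring.
Qed.

(* A truncated Fourier series of the extremal function, the Jacobi elliptic function [cn]:
   a multiple of [2000 cos x + 201 cos 3x + 19 cos 5x + 2 cos 7x]. *)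
Definition near_cn (x : R) : R :=
  739 * cos x + 268 * cos x ^ 3 + 40 * cos x ^ 5 + 64 * cos x ^ 7.
Definition near_cn' (x : R) : R :=
  - sin x * (739 + 804 * cos x ^ 2 + 200 * cos x ^ 4 + 448 * cos x ^ 6).
Definition near_cn'' (x : R) : R :=
  - cos x * (739 + 804 * cos x ^ 2 + 200 * cos x ^ 4 + 448 * cos x ^ 6)
  + sin x ^ 2 * (1608 * cos x + 800 * cos x ^ 3 + 2688 * cos x ^ 5).

Lemma derivative_on_of_is_derive L f f1 :
  (forall x, is_derive f x (f1 x)) -> derivative_on L f f1.
Proof.
intros H x Hx.
apply (limit1_imp _ (D_x no_cond x)); [now intros y [_ Hy]|].
apply (derivable_pt_lim_D_in f f1 x), is_derive_Reals, H.
Qed.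

Lemma near_cn_test_function : test_function PI near_cn near_cn'.
Proof.
split; [|split; [|split]].
- split.
  + apply derivative_on_of_is_derive; intros x; unfold near_cn, near_cn'.
    auto_derive; [easy | simpl; ring].
  + exists near_cn''; split.
    * apply derivative_on_of_is_derive; intros x; unfold near_cn', near_cn''.
      auto_derive; [easy | simpl; ring].
    * intros x _; apply (limit1_imp _ (D_x no_cond x)); [now intros y [_ Hy]|].
      change (continuity_pt near_cn'' x); apply continuity_pt_filterlim.
      apply (ex_derive_continuous near_cn''); unfold near_cn''; now auto_derive.
- unfold near_cn'; rewrite sin_0; ring.
- unfold near_cn'; rewrite sin_PI; ring.
- rewrite (RInt_ext _ (fun t => peval IZR [0; 739; 0; 268; 0; 40; 0; 64]%Z (cos t))).
  + rewrite RInt_cos_poly by (simpl; lia).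
    replace (dot _ _ _) with 0%Z by (vm_compute; reflexivity).
    unfold Rdiv; rewrite Rmult_0_l; apply Rmult_0_r.
  + intros x _; unfold near_cn; simpl; ring.
Qed.

(** All three integrals are PI times exact rationals [A], [B], [D], so the inequality would read
    [A <= C * PI^2 * B * D]. *)
Lemma near_cn_not_inequality C : C <= 0.1622773 -> ~ inequality C PI near_cn near_cn'.
Proof.
intros HC.
set (p := [0; 739; 0; 268; 0; 40; 0; 64]%Z).
set (q := [739; 0; 804; 0; 200; 0; 448]%Z).
set (o := poly_ops Z_ops).
assert (Ho : forall y, ring_eval o (fun p => peval IZR p y)) by (intros; apply poly_eval, Z_eval).
assert (Hp : forall n, RInt (fun s => near_cn s ^ n) 0 PI
                       = RInt (fun t => peval IZR (power o p n) (cos t)) 0 PI).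
{ intros n; apply RInt_ext; intros t _.
  rewrite (ev_power o _ p n (Ho (cos t))); apply (f_equal (fun y => y ^ n)).
  unfold near_cn; simpl; ring. }
assert (Hq : RInt (fun s => near_cn' s ^ 2) 0 PI
             = RInt (fun t => peval IZR (mul o [1; 0; -1]%Z (power o q 2)) (cos t)) 0 PI).
{ apply RInt_ext; intros t _.
  rewrite (ev_mul _ _ (Ho (cos t))), (ev_power o _ q 2 (Ho (cos t))).
  unfold near_cn'; rewrite Rpow_mult_distr.
  pose proof (sin2_cos2 t) as Hsc; rewrite !Rsqr_pow2 in Hsc.
  replace ((- sin t) ^ 2) with (1 - cos t ^ 2) by (simpl in *; lra).
  simpl; ring. }
unfold inequality; rewrite !Hp, Hq, !RInt_cos_poly by (vm_compute; lia).
set (a := dot _ (power o p 4) _); set (b := dot _ (power o p 2) _);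
  set (d := dot _ (mul o _ _) _).
vm_compute in a, b, d; subst a b d; unfold moment_scale.
pose proof PI_RGT_0 as Hpi0; pose proof PI_bounds as [_ Hpi].
set (A := _ / _); set (B := 37269488131873525022588928 / _); set (D := 40332237943919669296496640 / _).
intros H.
(* 9.869604402 bounds [PI^2] from above. The constant 0.1622773 exceeds 0.162277, so that the bound
   stays strict for the infimum. *)
assert (Hnum : 0.1622773 * 9.869604402 * (B * D) < A) by (unfold A, B, D; lra).
assert (HBD : 0 <= B * D) by (unfold B, D; lra).
clearbody A B D.
assert (Hsq : C * PI ^ 2 <= 0.1622773 * 9.869604402).
{ apply Rle_trans with (0.1622773 * PI ^ 2).
  - apply Rmult_le_compat_r; [apply pow2_ge_0 | exact HC].
  - apply Rmult_le_compat_l; [lra | nra]. }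
apply (Rmult_le_compat_r (B * D) _ _ HBD) in Hsq.
assert (A <= C * PI ^ 2 * (B * D)).
{ apply Rmult_le_reg_l with PI; [exact Hpi0|].
  replace (PI * (C * PI ^ 2 * (B * D))) with (C * PI * (PI * B) * (PI * D)) by ring.
  exact H. }
lra.
Qed.

(** * Existence and bounds of the optimal constant *)

Theorem mainTheorem3 :
  (exists Cstar : R,
     is_smallest admissible Cstar /\
     1 / (2 * PI) < 0.162277 /\
     0.162277 < Cstar /\
     Cstar < 0.162278) /\
  (exists (L : R) (u u1 : R -> R),
     0 < L /\ test_function L u u1 /\ ~ inequality (1 / (2 * PI)) L u u1).
Proof.
assert (Hpi : 3.1415 < PI) by (pose proof PI_bounds; unfold pi_num, const_den in *; lra).
assert (Hhalf : 1 / (2 * PI) < 0.162277).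
{ apply Rmult_lt_reg_r with (2 * PI); [lra|].
  replace (1 / (2 * PI) * (2 * PI)) with 1 by (field; lra); lra. }
split.
2:{ exists PI, near_cn, near_cn'; split; [lra|]; split; [apply near_cn_test_function|].
    apply near_cn_not_inequality; lra. }
assert (Hlower : forall C, admissible C -> 0.1622773 <= C).
{ intros C HC; apply Rnot_lt_le; intros Hlt.
  apply (near_cn_not_inequality C); [lra|].
  apply HC; [lra | apply near_cn_test_function]. }
(* The infimum of the admissible constants is obtained as minus the supremum of their negatives. *)
destruct (completeness (fun x => admissible (- x))) as [l [Hub Hlub]].
{ exists (- 0.1622773); intros x Hx; specialize (Hlower _ Hx); lra. }
{ exists (- (1 / (4 * kappa ^ 2))); rewrite Ropp_involutive; apply admissible_kappa. }
assert (Hle : forall C, admissible C -> - l <= C).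
{ intros C HC; assert (- C <= l) by (apply Hub; now rewrite Ropp_involutive); lra. }
assert (Hl : - l < 0.162278).
{ apply Rle_lt_trans with (1 := Hle _ admissible_kappa).
  assert (Hk : 0 < kappa) by (pose proof kappa_bounds; lra).
  apply Rmult_lt_reg_r with (4 * kappa ^ 2); [pose proof (pow_lt kappa 2 Hk); lra|].
  replace (1 / (4 * kappa ^ 2) * (4 * kappa ^ 2)) with 1 by (field; lra).
  unfold kappa, kappa_num, const_den; lra. }
exists (- l); split; [split; [|exact Hle]|].
- intros L u u1 HL Ht; unfold inequality.
  assert (HY := inequality_rhs_nonneg L u u1 HL Ht).
  pose (X := (RInt (fun s => u s ^ 4) 0 L) : R); change (X <= - l * L * RInt (fun s => u s ^ 2) 0 L * RInt (fun s => u1 s ^ 2) 0 L).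
  set (Y := L * _ * _) in HY.
  replace (- l * L * _ * _) with (- l * Y) by (unfold Y; ring).
  assert (Hadm : forall C, admissible C -> X <= C * Y).
  { intros C HC; specialize (HC L u u1 HL Ht); unfold inequality in HC.
    change (X <= C * L * RInt (fun s => u s ^ 2) 0 L * RInt (fun s => u1 s ^ 2) 0 L) in HC.
    unfold Y; lra. }
  (* The infimum is attained: for fixed [u] the condition is [X <= C * Y]. If [Y > 0], every
     admissible [C] is at least [X / Y]; if [Y = 0], one admissible constant already gives
     [X <= 0]. *)
  destruct (Rle_lt_or_eq_dec 0 Y HY) as [HY0|HY0].
  + assert (l <= - (X / Y)).
    { apply Hlub; intros x Hx; specialize (Hadm _ Hx).
      apply Ropp_le_cancel; rewrite Ropp_involutive.
      apply Rmult_le_reg_r with Y; [exact HY0|].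
      replace (X / Y * Y) with X by (field; lra); exact Hadm. }
    replace X with (X / Y * Y) by (field; lra).
    apply Rmult_le_compat_r; lra.
  + specialize (Hadm _ admissible_kappa); rewrite <- HY0 in *; lra.
- assert (0.1622773 <= - l).
  { assert (l <= - 0.1622773); [|lra].
    apply Hlub; intros x Hx; specialize (Hlower _ Hx); lra. }
  split; [exact Hhalf|]; split; lra.
Qed.
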